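(* Assume that the $(m,n)$-Padé approximant to $f$ is non-degenerate and that $a_{mn}\neq0$. For $\varepsilon>0$ let $r^\varepsilon\in\mathcal{R}_{mn}$ denote an $(m,n)$-rational Chebyshev approximant to $f$ on $\varepsilon K$, i.e. $$\|r^\varepsilon-f\|_{\varepsilon K}=\min_{r\in\mathcal{R}_{mn}}\|r-f\|_{\varepsilon K}.$$ Then there is a radius $\rho>0$ depending on $m$, $n$ and $K$ such that, for all sufficiently small $\varepsilon>0$, the difference $r^\varepsilon-f$ has exactly $m+n+1$ zeros in the disk $\varepsilon\rho\Delta$, counting multiplicity. In particular, for sufficiently small $\varepsilon$, Chebyshev approximation corresponds to interpolatory best approximation in $\mathcal{I}_{mn}^{\varepsilon\Theta}$ with $\Theta=\rho\Delta$, i.e. $r^\varepsilon\in\mathcal{I}_{mn}^{\varepsilon\Theta}$ and $$\|r^\varepsilon-f\|_{\varepsilon K}=\min_{r\in\mathcal{I}_{mn}^{\varepsilon\Theta}}\|r-f\|_{\varepsilon K}.$$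
   Context: Setting. $E\subset\mathbb{C}$ is a domain (open) containing the origin, $f:E\to\mathbb{C}$ is holomorphic, $K\subset E$ is a non-empty compact set without isolated points, and $m,n\ge 0$ are fixed integers. $\Delta=\{z\in\mathbb{C}:|z|\le1\}$. $\varepsilon S=\{\varepsilon z: z\in S\}$ for $\varepsilon>0$ and a set $S$; only $\varepsilon$ small enough that $\varepsilon K$ (and $\varepsilon\Theta$) lie in $E$ are considered. For a compact set $S$, $\|g\|_S=\max_{z\in S}|g(z)|$, with $\|g\|_S=\infty$ if $g$ has a pole in $S$. Rational functions. $\mathcal{R}_{mn}$ is the set of rational functions $p/q$ with $p,q$ complex polynomials of degree $\le m$ and $\le n$ respectively, $q\not\equiv0$. Chebyshev approximants exist but need not be unique; $r^\varepsilon$ is an arbitrary choice for each $\varepsilon$. The defect of $r\in\mathcal{R}_{mn}$ is the maximal $d\ge0$ with $r\in\mathcal{R}_{m-d,n-d}$ (the zero polynomial is the only polynomial of negative degree, so the zero function has defect $n$); $r$ is non-degenerate if its defect is $0$. Newton–Padé approximation. For nodes $z_0,\ldots,z_{m+n}\in E$ (repetitions allowed), there exist polynomials $p,q$, $q\not\equiv0$, of degree $\le m$, $\le n$, with $p(z)-q(z)f(z)=\widetilde v(z)\prod_{j=0}^{m+n}(z-z_j)$ for some $\widetilde v$ holomorphic on $E$; the quotient $r=p/q\in\mathcal{R}_{mn}$ is unique and is called the Newton–Padé approximant (rational interpolant) to $f$ with interpolation nodes $z_0,\ldots,z_{m+n}$. The $(m,n)$-Padé approximant $r^P$ is the Newton–Padé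 approximant for $z_0=\cdots=z_{m+n}=0$. If $r^P$ is non-degenerate it has no pole at $0$, and $a_{mn}\in\mathbb{C}$ is defined by $r^P(z)-f(z)=a_{mn}z^{m+n+1}+\mathcal{O}(z^{m+n+2})$ as $z\to0$. Interpolatory set. For $\Theta'\subset E$, $\mathcal{I}_{mn}^{\Theta'}$ is the set of $r\in\mathcal{R}_{mn}$ which are the Newton–Padé approximant to $f$ for some nodes $z_0,\ldots,z_{m+n}\in\Theta'$ (counting multiplicity). *)

(* Defs.v *)
From HB Require Import structures.
From mathcomp Require Import all_boot all_order all_algebra.
From mathcomp Require Import all_classical all_reals all_analysis.
From mathcomp Require Import complex.

Set Implicit Arguments.
Unset Strict Implicit.
Unset Printing Implicit Defensive.

Import Order.TTheory GRing.Theory Num.Theory.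
Import numFieldNormedType.Exports.

Local Open Scope classical_set_scope.
Local Open Scope ring_scope.

(* Declaring the complex field as a numClosedFieldType makes the standard norm
   topology of numFieldNormedType available on it, with [derivable f z 1] being
   complex differentiability at z. *)
Definition Cplx (R : realType) : numClosedFieldType := R[i].

Definition ratfun (R : realType) := {fraction {poly Cplx R}}.

Section Defs.
Variable R : realType.
Local Notation C := (Cplx R).
Implicit Types (E S : set C) (f h : C -> C) (p q : {poly C}) (r : ratfun R).

Definition holomorphic_on E f := forall z, E z -> derivable f z 1.

Definition disk : set C := [set z | `|z| <= 1].

Definition dil (c : R) S : set C := [set (c%:C)%C * z | z in S].

Definition ratio_of p q : ratfun R := FracField.tofrac p / FracField.tofrac q.

(* Degrees are integers because the defect involves R_(m-d, n-d) with m - d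
   possibly negative, where the numerator must be 0. *)
Definition deg_le p (k : int) := (p == 0) || ((size p)%:Z <= k + 1).

Definition ratfuns (m n : int) : set (ratfun R) :=
  [set r | exists p q, [/\ deg_le p m, deg_le q n, q != 0 & r = ratio_of p q]].

Definition is_defect (m n : nat) r (d : nat) :=
  ratfuns (m%:Z - d%:Z) (n%:Z - d%:Z) r /\
  forall d' : nat, ratfuns (m%:Z - d'%:Z) (n%:Z - d'%:Z) r -> (d' <= d)%N.

Definition nondegenerate_in m n r := is_defect m n r 0.

(* Numerator and denominator in lowest terms, up to a common nonzero constant;
   the pair chosen by [repr] need not be reduced. *)
Definition rnum r : {poly C} :=
  let nd := fraction.frac (repr r) in nd.1 %/ gcdp nd.1 nd.2.
Definition rden r : {poly C} :=
  let nd := fraction.frac (repr r) in nd.2 %/ gcdp nd.1 nd.2.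

Definition pole r (z : C) := root (rden r) z.

(* Meaningful only away from the poles of r. *)
Definition reval r (z : C) : C := (rnum r).[z] / (rden r).[z].

Definition sup_dist S r f : \bar R :=
  if `[< exists2 z, S z & pole r z >] then +oo%E
  else ereal_sup [set (Normc.normc (reval r z - f z))%:E | z in S].

(* r attains the minimum of the distance to f on S among elements of A. *)
Definition best_approx (A : set (ratfun R)) S f r :=
  A r /\ forall r', A r' -> (sup_dist S r f <= sup_dist S r' f)%E.

Definition newton_pade (m n : nat) E f (s : (m + n).+1.-tuple C) r :=
  (forall z, z \in s -> E z) /\
  exists p q, [/\ deg_le p m%:Z, deg_le q n%:Z, q != 0, r = ratio_of p q
    & exists2 v, holomorphic_on E v &
      forall z, E z ->
        p.[z] - q.[z] * f z = v z * \prod_(w <- s) (z - w)].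

Definition pade (m n : nat) E f r :=
  newton_pade E f (nseq_tuple (m + n).+1 (0 : C)) r.

Definition pade_coef (m n : nat) f r (a : C) :=
  (fun z : C => reval r z - f z - a * z ^+ (m + n).+1)
    =O_ (nbhs (0 : C)) (fun z : C => z ^+ (m + n).+2).

Definition interpolatory (m n : nat) E f S : set (ratfun R) :=
  [set r | exists2 s : (m + n).+1.-tuple C,
             forall z, z \in s -> S z & newton_pade E f s r].

Definition zero_order h (z : C) (k : nat) :=
  exists2 g : C -> C, g z != 0 &
    \forall w \near z, derivable g w 1 /\ h w = (w - z) ^+ k * g w.

Definition is_zero r f (z : C) := ~~ pole r z /\ reval r z - f z = 0.

(* s lists the zeros of r - f in S, each repeated according to multiplicity. *)
Definition nb_zeros S r f (N : nat) :=
  exists s : seq C,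
    [/\ size s = N,
        forall z, z \in s <-> S z /\ is_zero r f z
      & forall z, z \in s ->
          zero_order (fun w => reval r w - f w) z (count_mem z s)].

End Defs.

Arguments disk {R}.

(* Main.v *)
Require Import Defs.
From HB Require Import structures.
From mathcomp Require Import all_boot all_order all_algebra.
From mathcomp Require Import all_classical all_reals all_analysis.
From mathcomp Require Import complex ring lra.

(** The proof compares the Chebyshev approximant [r] on [eps K] with the Pade
    approximant [p1 / q1], for which [p1 - q1 * f = v * z ^ N] with [N = m + n + 1] and
    [v 0 != 0].

    Since [p1 / q1] competes in the Chebyshev problem, the error of [r = p / q] on
    [eps K] is of order [eps ^ N]. Hence so is the cross difference
    [D = p * q1 - p1 * q], a polynomial of degree less than [N]. As [K] is infinite, its
    values on [eps K] control its coefficients ([coef_le_values]). By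
    non-degeneracy, pairs [(p, q)] with vanishing cross difference are multiples of
    [(p1, q1)], and by linear algebra a small cross difference makes [q] nearly
    constant near 0 ([den_coef_le_cross]). In
    [q1 * (p - q * f) = D + q * v * z ^ N] the last term dominates as soon as
    [|z| >= eps * rho], where [rho] depends on [m], [n] and [K] only, and up to any fixed
    multiple of this radius ([near_pade_annulus]). So [p - q * f] grows like [z ^ N] on
    an annulus of large modulus, which forces exactly [N] zeros in the inner disk
    ([zero_count]). Dividing [p - q * f] by the corresponding linear factors gives the
    holomorphic cofactor that [newton_pade] asks for. Thus [r] is interpolatory, and it
    is best among interpolatory functions since these all lie in [ratfuns m n].

    The count of zeros rests on two facts about functions that are merely complex
    differentiable at each point of an open set: the maximum modulus principle and the
    divisibility by [z - z1] at a zero [z1]. Zeros are split off one at a time, and the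
    maximum modulus principle, applied to the cofactor or to its reciprocal, excludes
    every number of zeros other than [N].

    Both facts are proved without integration. Line integrals are replaced by
    trapezoidal sums, which are exact on affine functions, so that Goursat's
    subdivision of triangles applies to them ([goursat]). It yields
    [|h c| <= 2 * max |h|] for the value at the centre of a square
    ([center_le_twice]), and applying this to the powers of [h] turns the constant 2
    into 1 and allows finitely many points where [h] is only continuous
    ([max_modulus]). Removability of point singularities, hence the division at a zero,
    follows by applying the maximum modulus principle to differences of difference
    quotients ([removable_singularity]). *)

Set Implicit Arguments.
Unset Strict Implicit.
Unset Printing Implicit Defensive.

Import Order.TTheory GRing.Theory Num.Theory.
Import numFieldNormedType.Exports.

Local Open Scope classical_set_scope.
Local Open Scope ring_scope.

(** * The modulus and the topology of the complex field *)

Section Modulus.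
Variable R : realType.
Local Notation C := (Cplx R).
Implicit Types z w : C.

(** The norm of [Cplx R] takes its values in [Cplx R], whose order is partial; all
    estimates below are made with this real-valued modulus. *)
Definition nm z : R := Normc.normc (z : R[i]).

Lemma normE z : `|z| = ((nm z)%:C)%C :> C.
Proof. by []. Qed.

Lemma nmM z w : nm (z * w) = nm z * nm w.
Proof. exact: Normc.normcM. Qed.

Lemma nm0 : nm 0 = 0. Proof. exact: Normc.normc0. Qed.
Lemma nm1 : nm 1 = 1. Proof. exact: Normc.normc1. Qed.

Lemma nm_ge0 z : 0 <= nm z.
Proof. by case: z => a b; rewrite /nm /= sqrtr_ge0. Qed.

Lemma nm_eq0 z : (nm z == 0) = (z == 0).
Proof.
apply/eqP/eqP => [|->]; last exact: nm0.
exact: Normc.eq0_normc.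
Qed.

Lemma nm_gt0 z : (0 < nm z) = (z != 0).
Proof. by rewrite lt_def nm_ge0 andbT nm_eq0. Qed.

Lemma nmV z : nm z^-1 = (nm z)^-1.
Proof. exact: Normc.normcV. Qed.

Lemma nmN z : nm (- z) = nm z.
Proof. by case: z => a b; rewrite /nm /= !sqrrN. Qed.

Lemma nmB z w : nm (z - w) = nm (w - z).
Proof. by rewrite -nmN opprB. Qed.

Lemma nmD z w : nm (z + w) <= nm z + nm w.
Proof. exact: le_normcD. Qed.

Lemma nmDB z w : nm (z - w) <= nm z + nm w.
Proof. by rewrite -(nmN w) nmD. Qed.

Lemma nm_tri z w t : nm (z - w) <= nm (z - t) + nm (t - w).
Proof. by rewrite -[z - w](subrKA t) nmD. Qed.

Lemma nmX z k : nm (z ^+ k) = nm z ^+ k.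
Proof. by elim: k => [|k IH]; rewrite ?expr0 ?nm1 // !exprS nmM IH. Qed.

Lemma nm_sum (I : Type) (s : seq I) (F : I -> C) :
  nm (\sum_(i <- s) F i) <= \sum_(i <- s) nm (F i).
Proof.
elim: s => [|i s IH]; first by rewrite !big_nil nm0.
by rewrite !big_cons (le_trans (nmD _ _)) // lerD2l.
Qed.

Lemma nm_prod (I : Type) (s : seq I) (F : I -> C) :
  nm (\prod_(i <- s) F i) = \prod_(i <- s) nm (F i).
Proof. by apply: (big_morph nm nmM nm1). Qed.

Lemma nm_real (x : R) : nm (x%:C)%C = `|x|.
Proof. by rewrite /nm /= expr0n addr0 sqrtr_sqr. Qed.

Lemma Re_le_nm z : `|complex.Re (z : R[i])| <= nm z.
Proof.
by case: z => a b; rewrite /nm /= -sqrtr_sqr ler_sqrt ?lerDl ?addr_ge0 ?sqr_ge0.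
Qed.

Lemma Im_le_nm z : `|complex.Im (z : R[i])| <= nm z.
Proof.
by case: z => a b; rewrite /nm /= -sqrtr_sqr ler_sqrt ?lerDr ?addr_ge0 ?sqr_ge0.
Qed.

Lemma nm_le_ReIm z :
  nm z <= `|complex.Re (z : R[i])| + `|complex.Im (z : R[i])|.
Proof.
case: z => a b; rewrite /nm /=.
have h : 0 <= `|a| + `|b| by rewrite addr_ge0.
rewrite -[leRHS]ger0_norm // -sqrtr_sqr ler_sqrt ?sqr_ge0 //.
rewrite sqrrD !real_normK ?num_real // addrAC.
by rewrite lerDl mulrn_wge0 // mulr_ge0.
Qed.

Lemma nm_nat (k : nat) : nm k%:R = k%:R.
Proof.
have -> : (k%:R : C) = ((k%:R : R)%:C)%C.
  by rewrite (rmorph_nat (@real_complex R) k).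
by rewrite nm_real normr_nat.
Qed.

Lemma nbhsCP z (P : set C) :
  nbhs z P <-> exists2 d : R, 0 < d & forall w, nm (w - z) < d -> P w.
Proof.
split.
  move/nbhs_ballP => [e e0 He].
  have eE : e = ((complex.Re (e : R[i]))%:C)%C :> C.
    by rewrite [RHS]RRe_real // ; exact: gtr0_real.
  exists (complex.Re (e : R[i])).
    by rewrite -ltcR; move: e0; rewrite {1}eE.
  move=> w hw; apply: He; rewrite /ball /= eE normE nmB.
  by rewrite [_ < _]ltcR.
move=> [d d0 Hd]; apply/nbhs_ballP; exists (d%:C)%C.
  by rewrite /= [_ < _]ltcR.
move=> w; rewrite /ball /= normE => h; apply: Hd; rewrite nmB.
by move: h; rewrite [_ < _]ltcR.
Qed.

Lemma cvgCP (F : set_system C) {FF : Filter F} (h : C -> C) (l : C) :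
  (h @ F --> l) <-> forall e : R, 0 < e -> F [set w | nm (h w - l) < e].
Proof.
split=> [H e e0|H].
  have := H [set w | nm (w - l) < e]; apply.
  by apply: (nbhsCP _ _).2; exists e.
move=> P /(nbhsCP _ _).1 [d d0 Hd]; apply: filterS (H d d0) => w /=; exact: Hd.
Qed.

Lemma continuousCP (h : C -> C) z :
  {for z, continuous h} <->
  forall e : R, 0 < e ->
    exists2 d : R, 0 < d & forall w, nm (w - z) < d -> nm (h w - h z) < e.
Proof.
split=> [H e e0|H].
  exact: (nbhsCP _ _).1 ((@cvgCP (nbhs z) _ h (h z)).1 H e e0).
apply: (@cvgCP (nbhs z) _ h (h z)).2 => e e0; apply: (nbhsCP _ _).2; exact: H.
Qed.

Lemma derivableCP (h : C -> C) z :
  derivable h z 1 <-> exists l, forall e : R, 0 < e -> exists2 d : R, 0 < d &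
    forall w, nm (w - z) < d -> nm (h w - h z - l * (w - z)) <= e * nm (w - z).
Proof.
split.
  move=> /cvg_ex [l /(cvgCP _ _).1 Hl]; exists l => e e0.
  have /(nbhsCP _ _).1 [d d0 Hd] : nbhs (0 : C) (fun w => w != 0 ->
      nm (w^-1 *: ((h \o shift z) (w *: (1 : C)) - h z) - l) < e) := Hl e e0.
  exists d => // w hw.
  have [->|nwz] := eqVneq w z; first by rewrite !subrr mulr0 subrr nm0 mulr0.
  have wz0 : w - z != 0 by rewrite subr_eq0.
  have H : nm ((w - z)^-1 * (h w - h z) - l) < e.
    have := Hd (w - z); rewrite subr0 => /(_ hw wz0) /=.
    by rewrite /GRing.scale /= mulr1 subrK.
  have -> : h w - h z - l * (w - z) =
     ((w - z)^-1 * (h w - h z) - l) * (w - z).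
    by rewrite mulrBl mulrAC mulVf // mul1r.
  by rewrite nmM ler_wpM2r ?nm_ge0 // ltW.
move=> [l Hl]; apply/cvg_ex; exists l; apply: (@cvgCP (0^') _ _ _).2 => e e0.
have e20 : 0 < e / 2 by rewrite divr_gt0.
have [d d0 Hd] := Hl _ e20.
apply: (nbhsCP _ _).2; exists d => // w /=; rewrite subr0 => hw w0.
have := Hd (w + z); rewrite addrK => /(_ hw) H.
rewrite /GRing.scale /= mulr1.
have -> : w^-1 * (h (w + z) - h z) - l =
     (h (w + z) - h z - l * w) * w^-1.
  by rewrite [in RHS]mulrBl mulfK // mulrC.
have w1 : 0 < nm w by rewrite nm_gt0.
rewrite nmM nmV ltr_pdivrMr // (le_lt_trans H) // ltr_pM2r //.
by rewrite ltr_pdivrMr // ltr_pMr // ltr1n.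
Qed.

Lemma derivable_continuousC (h : C -> C) z :
  derivable h z 1 -> {for z, continuous h}.
Proof. by move=> /derivable1_diffP; exact: differentiable_continuous. Qed.

Lemma complete_real (u : nat -> R) :
  (forall e, 0 < e -> exists N, forall i j, (N <= i)%N -> (N <= j)%N ->
     `|u i - u j| <= e) ->
  exists l, forall e, 0 < e -> exists N, forall i, (N <= i)%N -> `|u i - l| <= e.
Proof.
move=> H.
have : cvg (u @ \oo).
  apply/cauchy_cvgP/cauchy_ballP => e e0; near_simpl.
  have e20 : 0 < e / 2 by rewrite divr_gt0.
  have [N HN] := H _ e20.
  near=> x y; rewrite /= /ball /=.
  apply: (@le_lt_trans _ _ (e / 2)).
    apply: HN; near: x + near: y; exact: nbhs_infty_ge.
  by rewrite ltr_pdivrMr // ltr_pMr // ltr1n.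
move=> /cvg_ex [l /cvgrPdistC_le Hl]; exists l => e e0.
by have [N _ HN] := Hl e e0; exists N => i hi; apply: HN.
Unshelve. all: by end_near. Qed.

Lemma complete_complex (u : nat -> C) :
  (forall e, 0 < e -> exists N, forall i j, (N <= i)%N -> (N <= j)%N ->
     nm (u i - u j) <= e) ->
  exists l, forall e, 0 < e -> exists N, forall i, (N <= i)%N -> nm (u i - l) <= e.
Proof.
move=> H.
have [a Ha] : exists l, forall e, 0 < e -> exists N, forall i, (N <= i)%N ->
    `|complex.Re (u i : R[i]) - l| <= e.
  apply: complete_real => e /H [N HN]; exists N => i j hi hj.
  apply: le_trans (HN i j hi hj); have := Re_le_nm (u i - u j).
  by move: (u i) (u j) => [x y] [x' y'].
have [b Hb] : exists l, forall e, 0 < e -> exists N, forall i, (N <= i)%N ->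
    `|complex.Im (u i : R[i]) - l| <= e.
  apply: complete_real => e /H [N HN]; exists N => i j hi hj.
  apply: le_trans (HN i j hi hj); have := Im_le_nm (u i - u j).
  by move: (u i) (u j) => [x y] [x' y'].
exists ((a +i* b)%C : C) => e e0.
have e20 : 0 < e / 2 by rewrite divr_gt0.
have [N1 H1] := Ha _ e20; have [N2 H2] := Hb _ e20.
exists (maxn N1 N2) => i; rewrite geq_max => /andP[hi1 hi2].
apply: le_trans (nm_le_ReIm _) _.
have := H1 _ hi1; have := H2 _ hi2.
case: (u i) => x y /= h2 h1; lra.
Qed.

End Modulus.

(** * Trapezoidal sums along segments and triangles *)

Section Trapezoid.
Variable R : realType.
Local Notation C := (Cplx R).
Implicit Types (a b c z w : C) (h : C -> C).

Definition seg (n : nat) a b (k : nat) : C := a + (b - a) * (k%:R / n%:R).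

(** The trapezoidal sum replaces the integral of [h] along the segment from [a] to
    [b]. It is exact on affine functions and additive under halving, and this is
    all that the proof of Goursat asks of an integral. *)
Definition trap (n : nat) h a b : C :=
  (b - a) / n%:R / 2 * \sum_(0 <= k < n) (h (seg n a b k) + h (seg n a b k.+1)).

Lemma trap_rev n h a b : (0 < n)%N -> trap n h b a = - trap n h a b.
Proof.
move=> n0; rewrite /trap -!mulNr opprB; congr (_ * _).
rewrite big_nat_rev /= add0n; apply: eq_big_nat => k /andP[_ kn].
have nN0 : (n%:R : C) != 0 by rewrite pnatr_eq0 -lt0n.
have segE j : (j <= n)%N -> seg n b a (n - j) = seg n a b j.
  by move=> jn; rewrite /seg natrB //; field.
by rewrite subnSK // addrC (segE k (ltnW kn)) segE.
Qed.

Lemma trap_half n h a b : (0 < n)%N ->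
  trap n.*2 h a b = trap n h a ((a + b) / 2) + trap n h ((a + b) / 2) b.
Proof.
move=> n0; rewrite /trap.
have nN0 : (n%:R : C) != 0 by rewrite pnatr_eq0 -lt0n.
have two0 : (2 : C) != 0 by rewrite pnatr_eq0.
have H1 k : seg n.*2 a b k = seg n a ((a + b) / 2) k.
  rewrite /seg -mul2n natrM; by field.
have H2 k : seg n.*2 a b (k + n) = seg n ((a + b) / 2) b k.
  rewrite /seg -mul2n natrM natrD; by field.
rewrite (big_cat_nat (leq0n n)) /=; last by rewrite -addnn leq_addr.
have -> (F : nat -> C) : \sum_(n <= k < n.*2) F k = \sum_(0 <= k < n) F (k + n)%N.
  by rewrite -{1}[n]add0n big_addn -addnn addnK.
rewrite mulrDr; congr (_ + _).
  rewrite -mul2n natrM; congr (_ * _); first by field.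
  by apply: eq_bigr => k _; rewrite mul2n !H1.
rewrite -mul2n natrM; congr (_ * _); first by field.
by apply: eq_bigr => k _; rewrite mul2n -addSn !H2.
Qed.

Lemma trapD n h1 h2 a b :
  trap n (fun z => h1 z + h2 z) a b = trap n h1 a b + trap n h2 a b.
Proof.
rewrite /trap -mulrDr -big_split /=; congr (_ * _).
by apply: eq_bigr => k _; rewrite addrACA.
Qed.

Lemma trapZ n (c : C) h a b : trap n (fun z => c * h z) a b = c * trap n h a b.
Proof.
rewrite /trap [RHS]mulrCA; congr (_ * _); rewrite mulr_sumr.
by apply: eq_bigr => k _; rewrite mulrDr.
Qed.

(** Each trapezoid of an affine function is an increment of its primitive, so that
    the sum telescopes. *)
Lemma trap_affine n (x y : C) a b : (0 < n)%N ->
  trap n (fun z => x + y * z) a b =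
  (x * b + y * b ^+ 2 / 2) - (x * a + y * a ^+ 2 / 2).
Proof.
move=> n0; rewrite /trap.
have nN0 : (n%:R : C) != 0 by rewrite pnatr_eq0 -lt0n.
have two0 : (2 : C) != 0 by rewrite pnatr_eq0.
pose P z := x * z + y * z ^+ 2 / 2.
have -> : x * b + y * b ^+ 2 / 2 = P (seg n a b n).
  by rewrite /P /seg divff //; field.
have -> : x * a + y * a ^+ 2 / 2 = P (seg n a b 0).
  by rewrite /P /seg mul0r mulr0 addr0.
rewrite -(telescope_sumr (fun k => P (seg n a b k)) (leq0n n)) mulr_sumr.
apply: eq_bigr => k _; rewrite /P /seg -natr1; by field.
Qed.

(** Disks are convex. *)
Lemma seg_near n a b k z (r : R) : (k <= n)%N -> (0 < n)%N ->
  nm (a - z) <= r -> nm (b - z) <= r -> nm (seg n a b k - z) <= r.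
Proof.
move=> kn n0 ha hb.
have nN0 : (n%:R : R) != 0 by rewrite pnatr_eq0 -lt0n.
pose t : R := k%:R / n%:R.
have t0 : 0 <= t by rewrite divr_ge0.
have t1 : t <= 1 by rewrite ler_pdivrMr ?ltr0n // mul1r ler_nat.
have tE : (k%:R / n%:R : C) = (t%:C)%C.
  by rewrite /t rmorphM fmorphV /= !rmorph_nat.
have -> : seg n a b k - z = ((1 - t)%:C)%C * (a - z) + (t%:C)%C * (b - z).
  rewrite /seg tE rmorphB rmorph1; ring.
apply: le_trans (nmD _ _) _; rewrite !nmM !nm_real ger0_norm ?subr_ge0 //.
rewrite ger0_norm //.
have := ler_wpM2l t0 hb.
have t2 : 0 <= 1 - t by rewrite subr_ge0.
have := ler_wpM2l t2 ha; lra.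
Qed.

Lemma trap_bound n h a b (M : R) : (0 < n)%N ->
  (forall k, (k <= n)%N -> nm (h (seg n a b k)) <= M) ->
  nm (trap n h a b) <= M * nm (b - a).
Proof.
move=> n0 H; rewrite /trap !nmM !nmV !nm_nat.
have nN0 : (0 : R) < n%:R by rewrite ltr0n.
have : nm (\sum_(0 <= k < n) (h (seg n a b k) + h (seg n a b k.+1))) <= (M * 2) * n%:R.
  apply: le_trans (nm_sum _ _) _.
  apply: (@le_trans _ _ (\sum_(0 <= k < n) (M * 2))).
    rewrite !big_seq; apply: ler_sum => k; rewrite mem_index_iota => /andP[_ kn].
    apply: le_trans (nmD _ _) _; rewrite mulr2n mulrDr mulr1.
    by rewrite lerD ?H // ltnW.
  by rewrite sumr_const_nat subn0 -[leLHS]mulr_natr.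
move=> H1.
have h0 : 0 <= nm (b - a) / n%:R / 2 by rewrite !divr_ge0 ?nm_ge0.
apply: le_trans (ler_wpM2l h0 H1) _.
rewrite le_eqVlt; apply/orP; left; apply/eqP; field.
by rewrite gt_eqF.
Qed.

Lemma eq_trap n h1 h2 a b : (0 < n)%N ->
  (forall k, (k <= n)%N -> h1 (seg n a b k) = h2 (seg n a b k)) ->
  trap n h1 a b = trap n h2 a b.
Proof.
move=> n0 H; rewrite /trap; congr (_ * _).
by apply: eq_big_nat => k /andP[_ kn]; rewrite !H // ltnW.
Qed.

Definition tri (M : nat) h a b c : C :=
  trap (2 ^ M) h a b + trap (2 ^ M) h b c + trap (2 ^ M) h c a.

Local Notation mid a b := ((a + b) / 2).

(** The sides of the middle triangle are run through in opposite directions by its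
    three neighbours. The number of nodes per side halves together with the sides,
    whence the shift from [M.+1] to [M]. *)
Lemma tri_split M h a b c :
  tri M.+1 h a b c =
    tri M h a (mid a b) (mid a c) + tri M h (mid a b) b (mid b c)
    + tri M h (mid a c) (mid b c) c + tri M h (mid a b) (mid b c) (mid a c).
Proof.
have M0 : (0 < 2 ^ M)%N by rewrite expn_gt0.
rewrite /tri expnS mul2n !trap_half //.
rewrite (addrC c a).
rewrite (trap_rev h (mid a b) (mid a c)) // (trap_rev h (mid b c) (mid a b)) //.
rewrite (trap_rev h (mid a c) (mid b c)) //.
ring.
Qed.

(** Only the deviation of [h] from its tangent at [z] contributes, as the closed
    sum of an affine function is 0; this deviation is at most [eta * r] on sides
    of length at most [2 * r]. *)
Lemma tri_near M h a b c z (l : C) (eta r : R) : 0 <= eta ->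
  nm (a - z) <= r -> nm (b - z) <= r -> nm (c - z) <= r ->
  (forall w, nm (w - z) <= r ->
     nm (h w - h z - l * (w - z)) <= eta * nm (w - z)) ->
  nm (tri M h a b c) <= 6 * eta * r ^+ 2.
Proof.
move=> e0 ha hb hc H.
have M0 : (0 < 2 ^ M)%N by rewrite expn_gt0.
have r0 : 0 <= r := le_trans (nm_ge0 _) ha.
pose err w := h w - h z - l * (w - z).
have key a' b' : nm (a' - z) <= r -> nm (b' - z) <= r ->
    nm (trap (2 ^ M) err a' b') <= 2 * eta * r ^+ 2.
  move=> ha' hb'.
  have h1 : nm (trap (2 ^ M) err a' b') <= (eta * r) * nm (b' - a').
    apply: trap_bound => // k kn.
    have h2 := seg_near kn M0 ha' hb'.
    by apply: le_trans (H _ h2) _; rewrite ler_wpM2l.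
  apply: le_trans h1 _.
  have h3 : nm (b' - a') <= 2 * r.
    have := nm_tri b' a' z; rewrite (nmB z a'); lra.
  have h4 : 0 <= eta * r by rewrite mulr_ge0.
  have := ler_wpM2l h4 h3; rewrite expr2; lra.
have dec a' b' : trap (2 ^ M) h a' b' = trap (2 ^ M) err a' b' +
    (((h z - l * z) * b' + l * b' ^+ 2 / 2) -
     ((h z - l * z) * a' + l * a' ^+ 2 / 2)).
  rewrite -(trap_affine _ _ a' b' M0) -trapD; apply: eq_trap => // k _.
  rewrite /err; ring.
have -> : tri M h a b c = trap (2 ^ M) err a b + trap (2 ^ M) err b c
    + trap (2 ^ M) err c a.
  rewrite /tri !dec; ring.
have := nmD (trap (2 ^ M) err a b + trap (2 ^ M) err b c) (trap (2 ^ M) err c a).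
have := nmD (trap (2 ^ M) err a b) (trap (2 ^ M) err b c).
have := key _ _ ha hb; have := key _ _ hb hc; have := key _ _ hc ha; lra.
Qed.

End Trapezoid.

(** * Goursat's lemma *)

Section Goursat.
Variable R : realType.
Local Notation C := (Cplx R).
Implicit Types (a b c z w : C) (h : C -> C).
Local Notation mid a b := ((a + b) / 2).

Definition tends0 (u : nat -> C) :=
  forall e : R, 0 < e -> exists M0, forall M, (M0 <= M)%N -> nm (u M) <= e.

Lemma half_powers_vanish (d x : R) : 0 < x -> exists N, d / 2 ^+ N <= x.
Proof.
move=> x0; exists (Num.truncn (d / x)).+1.
rewrite ler_pdivrMr ?exprn_gt0 // mulrC -ler_pdivrMr //.
apply: le_trans (ltW (truncnS_gt _)) _.
by rewrite -natrX ler_nat ltnW // ltn_expl.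
Qed.

Lemma mid_dist a b : nm (mid a b - a) = nm (b - a) / 2.
Proof.
have -> : mid a b - a = (b - a) / 2 by field.
by rewrite nmM nmV nm_nat.
Qed.

Lemma mid_sub a b c : nm (mid a b - mid a c) = nm (b - c) / 2.
Proof.
have -> : mid a b - mid a c = (b - c) / 2 by field.
by rewrite nmM nmV nm_nat.
Qed.

(** Goursat's argument. If the circulation around a triangle does not fall below
    [e], that of one of its four quarters does not fall below [e / 4]. The nested
    bad triangles shrink to a point where differentiability gives a circulation of
    smaller order than the square of the diameter. *)
Lemma goursat (S : set C) h a b c :
  (forall z, (forall e : R, 0 < e -> exists2 w, S w & nm (w - z) < e) -> S z) ->
  (forall x y, S x -> S y -> S (mid x y)) ->
  (forall z, S z -> derivable h z 1) ->
  S a -> S b -> S c -> tends0 (fun M => tri M h a b c).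
Proof.
move=> Sclosed Smid Sh Sa Sb Sc e e0; apply: contrapT => bad.
pose bound a' b' c' (e' : R) :=
  exists M0, forall M, (M0 <= M)%N -> nm (tri M h a' b' c') <= e'.
pose d : R := nm (a - b) + nm (b - c) + nm (c - a).
pose inv (u : nat * (C * C * C)) :=
  let: (j, (a', b', c')) := u in
  [/\ [/\ S a', S b' & S c'],
      [/\ nm (a' - b') <= d / 2 ^+ j, nm (b' - c') <= d / 2 ^+ j
        & nm (c' - a') <= d / 2 ^+ j]
      & ~ bound a' b' c' (e / 4 ^+ j)].
pose step (u v : {u | inv u}) :=
  (sval v).1 = (sval u).1.+1 /\
  nm ((sval v).2.1.1 - (sval u).2.1.1) <= d / 2 ^+ (sval u).1.+1.
have nxt (u : {u | inv u}) : {v | step u v}.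
  apply/cid; case: u => -[j [[a' b'] c']] I; rewrite /step /=.
  case: (I) => -[Sa' Sb' Sc'] [dab dbc dca] nb.
  have halve x : x <= d / 2 ^+ j -> x / 2 <= d / 2 ^+ j.+1.
    move=> hx; rewrite exprS invfM [2^-1 * _]mulrC mulrA.
    by rewrite ler_pM2r // invr_gt0.
  have dba : nm (b' - a') <= d / 2 ^+ j by rewrite nmB.
  have dcb : nm (c' - b') <= d / 2 ^+ j by rewrite nmB.
  have dac : nm (a' - c') <= d / 2 ^+ j by rewrite nmB.
  have [[v Iv Dv] | none] := pselect (exists2 v, inv v &
      v.1 = j.+1 /\ nm (v.2.1.1 - a') <= d / 2 ^+ j.+1).
    by exists (exist _ v Iv).
  exfalso; apply: nb.
  have e4 : e / 4 ^+ j = e / 4 ^+ j.+1 + e / 4 ^+ j.+1 + e / 4 ^+ j.+1 + e / 4 ^+ j.+1.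
    rewrite exprS; field; by rewrite expf_neq0.
  have small x y z : S x -> S y -> S z -> nm (x - y) <= d / 2 ^+ j.+1 ->
      nm (y - z) <= d / 2 ^+ j.+1 -> nm (z - x) <= d / 2 ^+ j.+1 ->
      nm (x - a') <= d / 2 ^+ j.+1 -> bound x y z (e / 4 ^+ j.+1).
    move=> Sx Sy Sz xy yz zx xa; apply: contrapT => nb'; apply: none.
    by exists (j.+1, (x, y, z)).
  have d0 : 0 <= d / 2 ^+ j.+1.
    by rewrite (le_trans _ (halve _ dab)) // divr_ge0 ?nm_ge0.
  have midC x y : mid x y = mid y x by rewrite addrC.
  have [|||||||M1 H1] := small a' (mid a' b') (mid a' c') => //; try exact: Smid.
  - by rewrite nmB mid_dist halve.
  - by rewrite mid_sub halve.
  - by rewrite mid_dist halve.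
  - by rewrite subrr nm0.
  have [|||||||M2 H2] := small (mid a' b') b' (mid b' c') => //; try exact: Smid.
  - by rewrite midC mid_dist halve.
  - by rewrite nmB mid_dist halve.
  - by rewrite [mid a' b']midC mid_sub halve.
  - by rewrite mid_dist halve.
  have [|||||||M3 H3] := small (mid a' c') (mid b' c') c' => //; try exact: Smid.
  - by rewrite ![mid _ c']midC mid_sub halve.
  - by rewrite midC mid_dist halve.
  - by rewrite nmB midC mid_dist halve.
  - by rewrite mid_dist halve.
  have [|||||||M4 H4] := small (mid a' b') (mid b' c') (mid a' c') => //; try exact: Smid.
  - by rewrite [mid a' b']midC mid_sub halve.
  - by rewrite ![mid _ c']midC mid_sub halve.
  - by rewrite mid_sub halve.
  - by rewrite mid_dist halve.
  exists (M1 + M2 + M3 + M4).+1%N => -[//|M]; rewrite ltnS => hM.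
  rewrite tri_split e4.
  apply: le_trans (nmD _ _) (lerD _ _);
    first apply: le_trans (nmD _ _) (lerD _ _);
    first apply: le_trans (nmD _ _) (lerD _ _).
  - by apply: H1; apply: leq_trans hM; rewrite -!addnA leq_addr.
  - by apply: H2; apply: leq_trans hM; rewrite -!addnA addnCA leq_addr.
  - by apply: H3; apply: leq_trans hM; rewrite [leqRHS]addnAC leq_addl.
  - by apply: H4; apply: leq_trans hM; rewrite leq_addl.
have I0 : inv (0, (a, b, c)).
  have [p1 p2 p3] := And3 (nm_ge0 (a - b)) (nm_ge0 (b - c)) (nm_ge0 (c - a)).
  split=> //; last by rewrite expr0 divr1.
  by rewrite expr0 divr1 /d; split; lra.
have [u [u0 uS]] := dependent_choice nxt (exist _ _ I0).
have uj j : (sval (u j)).1 = j.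
  by elim: j => [|j IH]; [rewrite u0|have [-> _] := uS j; rewrite IH].
pose p j := (sval (u j)).2.1.1.
have d0 : 0 <= d by rewrite /d !addr_ge0 ?nm_ge0.
have pj i k : nm (p (i + k)%N - p i) <= d / 2 ^+ i - d / 2 ^+ (i + k).
  elim: k => [|k IH]; first by rewrite addn0 !subrr nm0.
  apply: le_trans (nm_tri _ _ (p (i + k)%N)) _.
  have [_] := uS (i + k)%N; rewrite uj -/(p _) addnS -/(p _).
  move: IH; rewrite exprS invfM => IH H.
  have h2 : d / 2 ^+ (i + k) = d * (2^-1 / 2 ^+ (i + k)) *+ 2.
    rewrite mulr2n; field; by rewrite expf_neq0.
  move: IH H h2; set X := nm _; set Y := nm _; rewrite mulr2n; lra.
have pw (i : nat) : 0 <= d / 2 ^+ i by rewrite divr_ge0 // exprn_ge0.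
have small_pow (x : R) : 0 < x -> exists N, d / 2 ^+ N <= x.
  exact: half_powers_vanish.
have [z Hz] : exists l, forall e, 0 < e -> exists N, forall i, (N <= i)%N ->
    nm (p i - l) <= e.
  apply: complete_complex => x x0.
  have x20 : 0 < x / 2 by rewrite divr_gt0.
  have [N HN] := small_pow _ x20; exists N => i j hi hj.
  have key k : (N <= k)%N -> nm (p k - p N) <= x / 2.
    move=> hk; rewrite -(subnKC hk); apply: le_trans (pj _ _) _.
    by apply: le_trans HN; rewrite gerBl.
  have := key _ hi; have := key _ hj; have := nm_tri (p i) (p j) (p N).
  rewrite (nmB (p N)); lra.
have pz j : nm (p j - z) <= d / 2 ^+ j.
  apply/ler_addgt0Pr => x x0; have [N HN] := Hz x x0.
  have h1 := HN (N + j)%N (leq_addr _ _).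
  have := pj j N; rewrite addnC nmB => h2.
  have := nm_tri (p j) z (p (N + j)%N); have := pw (N + j)%N; lra.
have Sz : S z.
  apply: Sclosed => x x0.
  have x20 : 0 < x / 2 by rewrite divr_gt0.
  have [N HN] := small_pow _ x20.
  exists (p N); last by have := pz N; lra.
  rewrite /p; case: (u N) => -[k [[a' b'] c']] /=; by case=> -[].
have [l Hl] := (derivableCP _ _).1 (Sh z Sz).
(* the nodes lie within [2 * (d / 2 ^ N)] of [z], and [tri_near] then bounds the
   sum by [24 * eta * d ^ 2 / 4 ^ N] *)
pose eta := e / (24 * d ^+ 2 + 1).
have d2 : 0 <= d ^+ 2 by rewrite exprn_ge0.
have dd0 : 0 < 24 * d ^+ 2 + 1 by lra.
have eta0 : 0 < eta by rewrite divr_gt0.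
have [r r0 Hr] := Hl _ eta0.
have r40 : 0 < r / 4 by rewrite divr_gt0.
have [N HN] := small_pow _ r40.
have := pz N; have := uj N; rewrite /p.
case: (u N) => -[k [[a' b'] c']] /= I kN pa; subst k.
case: I => _ [dab dbc dca]; apply; exists 0 => M _.
have := @tri_near R M h a' b' c' z l eta (2 * (d / 2 ^+ N)) (ltW eta0).
move=> H; apply: le_trans (H _ _ _ _) _.
- have := pw N; lra.
- have := nm_tri b' z a'; rewrite (nmB b' a'); lra.
- have := nm_tri c' z a'; lra.
- move=> w hw; apply: Hr; lra.
have -> : 6 * eta * (2 * (d / 2 ^+ N)) ^+ 2 = (eta * (24 * d ^+ 2)) / 4 ^+ N.
  have -> : (4 : R) = 2 ^+ 2 by rewrite expr2; lra.
  rewrite -exprM mulnC exprM; field; by rewrite expf_neq0.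
rewrite ler_pM2r ?invr_gt0 ?exprn_gt0 //.
have -> : e = eta * (24 * d ^+ 2 + 1) by rewrite /eta mulfVK // gt_eqF.
by rewrite ler_pM2l // lerDl.
Qed.
End Goursat.

(** * Goursat's lemma with a point singularity *)

Section Cauchy.
Variable R : realType.
Local Notation C := (Cplx R).
Implicit Types (a b c z w : C) (h : C -> C).
Local Notation mid a b := ((a + b) / 2).
Local Notation Re z := (complex.Re (z : R[i])).

Lemma eq_tends0 (u v : nat -> C) : u =1 v -> tends0 u -> tends0 v.
Proof. by move=> /funext ->. Qed.

Lemma tends0D (u v : nat -> C) :
  tends0 u -> tends0 v -> tends0 (fun M => u M + v M).
Proof.
move=> Hu Hv e e0.
have e20 : 0 < e / 2 by rewrite divr_gt0.
have [M1 H1] := Hu _ e20; have [M2 H2] := Hv _ e20.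
exists (M1 + M2)%N => M hM; apply: le_trans (nmD _ _) _.
have := H1 M (leq_trans (leq_addr _ _) hM).
have := H2 M (leq_trans (leq_addl _ _) hM); lra.
Qed.

Lemma ReD z w : Re (z + w) = Re z + Re w.
Proof. by case: z; case: w. Qed.

Lemma ReB z w : Re (z - w) = Re z - Re w.
Proof. by case: z; case: w. Qed.

Lemma ReM_real (x : R) z : Re ((x%:C)%C * z) = x * Re z.
Proof. by case: z => a b /=; rewrite mul0r subr0. Qed.

Lemma halfE : (2^-1 : C) = ((2^-1 : R)%:C)%C.
Proof. by rewrite fmorphV /= (rmorph_nat (@real_complex R)). Qed.

Lemma Re_half z : Re (z / 2) = Re z / 2.
Proof. by rewrite halfE mulrC ReM_real mulrC. Qed.

(** Of the four quarters of the triangle with apex [c], the three that do not touch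
    [c] lie in a convex set on which [h] is differentiable: the half-plane given by
    the linear form [Re (u * _)] separates them from [c]. *)
Lemma tri_apex_step h c u (r lam : R) al be :
  (forall z, nm (z - c) <= r -> z != c -> derivable h z 1) ->
  nm al <= r -> nm be <= r -> 0 < lam -> lam <= Re (u * al) -> lam <= Re (u * be) ->
  tends0 (fun M => tri M.+1 h c (c + al) (c + be) -
                   tri M h c (c + al / 2) (c + be / 2)).
Proof.
move=> Hh hal hbe lam0 Ral Rbe.
pose S : set C := [set z | nm (z - c) <= r /\ lam / 2 <= Re (u * (z - c))].
have Sclosed z : (forall e : R, 0 < e -> exists2 w, S w & nm (w - z) < e) -> S z.
  move=> Hz; split; apply/ler_addgt0Pr => e e0.
    have [w [Sw _] hw] := Hz e e0.
    have := nm_tri z c w; rewrite (nmB z w); lra.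
  have u1 : 0 < nm u + 1 by have := nm_ge0 u; lra.
  have e1 : 0 < e / (nm u + 1) by rewrite divr_gt0.
  have [w [_ Sw] hw] := Hz _ e1.
  have -> : u * (z - c) = u * (w - c) - u * (w - z) by ring.
  rewrite ReB.
  have h1 := le_trans (ler_norm _) (Re_le_nm (u * (w - z))).
  move: h1; rewrite nmM => h1.
  have h2 : nm u * nm (w - z) <= e.
    apply: (@le_trans _ _ ((nm u + 1) * (e / (nm u + 1)))).
      apply: ler_pM; rewrite ?nm_ge0 ?(ltW hw) //; lra.
    by rewrite mulrC mulfVK // gt_eqF.
  lra.
have Smid x y : S x -> S y -> S (mid x y).
  move=> [hx Rx] [hy Ry]; split.
    have -> : mid x y - c = (x - c) / 2 + (y - c) / 2 by field.
    apply: le_trans (nmD _ _) _; rewrite !nmM !nmV !nm_nat; lra.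
  have -> : u * (mid x y - c) = u * (x - c) / 2 + u * (y - c) / 2 by field.
  rewrite ReD !Re_half; lra.
have Sh z : S z -> derivable h z 1.
  move=> [hz Rz]; apply: Hh => //; apply/eqP => zc.
  move: Rz; rewrite zc subrr mulr0 /=; lra.
have r0 : 0 <= r := le_trans (nm_ge0 _) hal.
have Sa : S (c + al) by rewrite /S /= addrAC subrr add0r; split=> //; lra.
have Sb : S (c + be) by rewrite /S /= addrAC subrr add0r; split=> //; lra.
have Sa2 : S (c + al / 2).
  rewrite /S /= addrAC subrr add0r; split; first by rewrite nmM nmV nm_nat; lra.
  rewrite mulrA Re_half; lra.
have Sb2 : S (c + be / 2).
  rewrite /S /= addrAC subrr add0r; split; first by rewrite nmM nmV nm_nat; lra.
  rewrite mulrA Re_half; lra.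
have G x y z Sx Sy Sz := @goursat R S h x y z Sclosed Smid Sh Sx Sy Sz.
have ma : mid c (c + al) = c + al / 2 by field.
have mb : mid c (c + be) = c + be / 2 by field.
have mab : S (mid (c + al) (c + be)) by exact: Smid.
apply: (eq_tends0 _ (tends0D (tends0D (G _ _ _ Sa2 Sa mab) (G _ _ _ Sb2 mab Sb))
  (G _ _ _ Sa2 mab Sb2))) => M; rewrite tri_split ma mb; ring.
Qed.

(** A point singularity at which [h] stays bounded is invisible to the
    triangle sums: shrinking the triangle towards its apex makes the only
    piece containing the singularity arbitrarily short. *)
Lemma tri_apex h c u (r lam B d0 : R) al be :
  (forall z, nm (z - c) <= r -> z != c -> derivable h z 1) ->
  0 < d0 -> (forall w, nm (w - c) <= d0 -> nm (h w) <= B) ->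
  nm al <= r -> nm be <= r -> 0 < lam -> lam <= Re (u * al) -> lam <= Re (u * be) ->
  tends0 (fun M => tri M h c (c + al) (c + be)).
Proof.
move=> Hh d00 HB hal hbe lam0 Ral Rbe.
have B0 : 0 <= B.
  by apply: le_trans (nm_ge0 _) (HB c _); rewrite subrr nm0 ltW.
have key j : forall (lam r' : R) al be, r' <= r -> 
    nm al <= r' -> nm be <= r' -> 0 < lam -> lam <= Re (u * al) -> lam <= Re (u * be) ->
    r' / 2 ^+ j <= d0 -> forall e : R, 0 < e -> exists M0, forall M, (M0 <= M)%N ->
    nm (tri M h c (c + al) (c + be)) <= 4 * B * (r' / 2 ^+ j) + e.
  elim: j => [|j IH] {lam0 Ral Rbe hal hbe al be} {}lam r' al be
    rr hal hbe lam0 Ral Rbe hj e e0.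
    move: hj; rewrite expr0 divr1 => hj; exists 0 => M _.
    have r0 : 0 <= r' := le_trans (nm_ge0 _) hal.
    have M0 : (0 < 2 ^ M)%N by rewrite expn_gt0.
    have side x y : nm (x - c) <= r' -> nm (y - c) <= r' ->
        nm (trap (2 ^ M) h x y) <= B * nm (y - x).
      move=> hx hy; apply: trap_bound => // k kn; apply: HB.
      by apply: le_trans hj; apply: seg_near.
    have c0 : nm (c - c) <= r' by rewrite subrr nm0.
    have ca : nm (c + al - c) <= r' by rewrite addrAC subrr add0r.
    have cb : nm (c + be - c) <= r' by rewrite addrAC subrr add0r.
    have := side _ _ c0 ca; have := side _ _ ca cb; have := side _ _ cb c0.
    rewrite /tri; set X := trap _ _ _ _; set Y := trap _ _ _ _; set Z := trap _ _ _ _.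
    have h3 := ler_wpM2l B0 ca.
    have h4 : nm (c - (c + be)) <= r' by rewrite nmB.
    have h5 := ler_wpM2l B0 h4.
    have h6 : nm (c + be - (c + al)) <= 2 * r'.
      have := nm_tri (c + be) (c + al) c; rewrite (nmB c (c + al)); lra.
    have h7 := ler_wpM2l B0 h6.
    have := nmD (Z + Y) X; have := nmD Z Y; lra.
  have [M1 H1] : exists M0, forall M, (M0 <= M)%N ->
      nm (tri M h c (c + al / 2) (c + be / 2)) <= 4 * B * (r' / 2 / 2 ^+ j) + e / 2.
    apply: (IH (lam / 2)).
    - have r0 : 0 <= r' := le_trans (nm_ge0 _) hal; lra.
    - by rewrite nmM nmV nm_nat ler_pM2r.
    - by rewrite nmM nmV nm_nat ler_pM2r.
    - by rewrite divr_gt0.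
    - by rewrite mulrA Re_half ler_pM2r.
    - by rewrite mulrA Re_half ler_pM2r.
    - by rewrite -mulrA -invfM -exprS.
    - by rewrite divr_gt0.
  have e20 : 0 < e / 2 by rewrite divr_gt0.
  have Hh' z : nm (z - c) <= r' -> z != c -> derivable h z 1.
    by move=> hz; apply: Hh; apply: le_trans rr.
  have [M2 H2] := @tri_apex_step h c u r' lam al be Hh' hal hbe lam0 Ral Rbe _ e20.
  exists (M1 + M2).+1%N => -[//|M]; rewrite ltnS => hM.
  have := H1 M (leq_trans (leq_addr _ _) hM).
  have := H2 M (leq_trans (leq_addl _ _) hM).
  rewrite -[r' / 2 / _]mulrA -invfM -exprS.
  set X := tri M.+1 _ _ _ _; set Y := tri M _ _ _ _ => h1 h2.
  have := nmD (X - Y) Y; rewrite subrK; lra.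
move=> e e0.
have q0 : 0 < Num.min d0 (e / (8 * B + 1)).
  by rewrite lt_min d00 divr_gt0 //; lra.
have [j] := half_powers_vanish r q0; rewrite le_min => /andP[hj1 hj2].
have e20 : 0 < e / 2 by rewrite divr_gt0.
have [M0 HM] := key j lam r al be (lexx _) hal hbe lam0 Ral Rbe hj1 _ e20.
exists M0 => M /HM hM; apply: le_trans hM _.
have B1 : 0 < 8 * B + 1 by lra.
move: hj2; rewrite ler_pdivlMr //; set X := r / _ => hX.
have : 0 <= X by rewrite divr_ge0 ?exprn_ge0 // (le_trans (nm_ge0 _) hal).
lra.
Qed.

End Cauchy.

(** * A Cauchy estimate on squares *)

Section MaxModulus.
Variable R : realType.
Local Notation C := (Cplx R).
Implicit Types (a b c z w : C) (h : C -> C).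
Local Notation Re z := (complex.Re (z : R[i])).
Local Notation Im z := (complex.Im (z : R[i])).

(** The square with vertices [c + k * sq_lo] and [c + k * sq_hi], where [k] runs
    over a real number times the fourth roots of unity, is the closed contour used
    for the Cauchy formula: by rotation its four sides behave alike. *)
Definition sq_lo : C := (Complex 1 (-1) : R[i]).
Definition sq_hi : C := (Complex 1 1 : R[i]).
Definition imu : C := (Complex 0 1 : R[i]).

Lemma imu_lo : imu * sq_lo = sq_hi.
Proof. by apply/eqP; rewrite eq_complex /=; apply/andP; split; apply/eqP; ring. Qed.

Lemma imu2 : imu * imu = -1.
Proof. by apply/eqP; rewrite eq_complex /=; apply/andP; split; apply/eqP; ring. Qed.

Lemma hi_sub_lo : sq_hi - sq_lo = 2 * imu.
Proof.
have -> : (2 : C) = ((2 : R)%:C)%C by rewrite (rmorph_nat (@real_complex R)).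
by apply/eqP; rewrite eq_complex /=; apply/andP; split; apply/eqP; ring.
Qed.

Lemma nm_imu : nm imu = 1.
Proof. by rewrite /nm /= expr0n expr1n add0r sqrtr1. Qed.

Lemma seg_side (n k : nat) :
  seg n sq_lo sq_hi k = (Complex 1 (2 * (k%:R / n%:R) - 1) : R[i]).
Proof.
rewrite /seg hi_sub_lo.
have -> : (2 * imu * (k%:R / n%:R) : C) = imu * ((2 * (k%:R / n%:R) : R)%:C)%C.
  by rewrite !rmorphM fmorphV !rmorph_nat /=; ring.
by apply/eqP; rewrite eq_complex /=; apply/andP; split; apply/eqP; ring.
Qed.

Lemma side_param (n k : nat) : (0 < n)%N -> (k <= n)%N ->
  `|2 * (k%:R / n%:R) - 1 : R| <= 1.
Proof.
move=> n0 kn; have t0 : 0 <= (k%:R / n%:R : R) by rewrite divr_ge0.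
have t1 : (k%:R / n%:R : R) <= 1 by rewrite ler_pdivrMr ?ltr0n // mul1r ler_nat.
rewrite ler_norml; lra.
Qed.

Lemma nm_side (n k : nat) : (0 < n)%N -> (k <= n)%N ->
  1 <= nm (seg n sq_lo sq_hi k) <= 2.
Proof.
move=> n0 kn; have := side_param n0 kn; rewrite seg_side.
set w : C := (Complex _ _ : R[i]) => ht.
have := Re_le_nm w; have := nm_le_ReIm w; rewrite /w /= normr1 => h1 h2.
by rewrite h2 (le_trans h1) //; lra.
Qed.

(** The sum over one side approximates the angle under which the side is seen
    from the centre, hence stays away from 0. *)
Lemma side_kernel (n : nat) : (0 < n)%N ->
  1 <= nm (trap n (fun z => z^-1) sq_lo sq_hi).
Proof.
move=> n0; apply: le_trans (Im_le_nm _); apply: le_trans (ler_norm _).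
rewrite /trap hi_sub_lo.
set S := \sum_(_ <= _ < _) _.
have nN0 : (n%:R : C) != 0 by rewrite pnatr_eq0 -lt0n.
have nR0 : (0 : R) < n%:R by rewrite ltr0n.
have -> : 2 * imu / n%:R / 2 * S = (((n%:R : R)^-1)%:C)%C * (imu * S).
  by rewrite fmorphV /= (rmorph_nat (@real_complex R)); field.
have -> z : Im ((((n%:R : R)^-1)%:C)%C * (imu * z)) = n%:R^-1 * Re z.
  by case: z => x y /=; ring.
suff : n%:R <= Re S by move=> H; rewrite mulrC ler_pdivlMr // mul1r.
have Re_sum (F : nat -> C) (m : nat) :
    Re (\sum_(0 <= k < m) F k) = \sum_(0 <= k < m) Re (F k).
  elim: m => [|m IH]; first by rewrite !big_geq.
  by rewrite !big_nat_recr //= ReD IH.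
rewrite /S Re_sum.
have half k : (k <= n)%N -> 2^-1 <= Re (seg n sq_lo sq_hi k)^-1.
  move=> kn; rewrite seg_side /=; have := side_param n0 kn.
  set t : R := _ - 1 => ht.
  have t2 : t ^+ 2 <= 1.
    by rewrite -real_normK ?num_real // expr_le1.
  have t0 : 0 <= t ^+ 2 by exact: sqr_ge0.
  rewrite expr1n div1r lef_pV2 ?posrE; lra.
have -> : (n%:R : R) = \sum_(0 <= k < n) 1 by rewrite sumr_const_nat subn0.
rewrite !big_seq; apply: ler_sum => k; rewrite mem_index_iota => /andP[_ kn].
rewrite ReD; have := half _ kn; have := half _ (ltnW kn); lra.
Qed.

Lemma seg_affine n c kap a b k :
  seg n (c + kap * a) (c + kap * b) k = c + kap * seg n a b k.
Proof. rewrite /seg; ring. Qed.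

(** [dz / (z - c)] is invariant under similarities fixing [c]. *)
Lemma side_scale n c kap a b : kap != 0 ->
  trap n (fun z => (z - c)^-1) (c + kap * a) (c + kap * b) =
  trap n (fun z => z^-1) a b.
Proof.
move=> k0; rewrite /trap.
have E k : (seg n (c + kap * a) (c + kap * b) k - c)^-1 = kap^-1 * (seg n a b k)^-1.
  by rewrite seg_affine addrAC subrr add0r invfM.
under eq_bigr do rewrite !E -mulrDr.
rewrite -mulr_sumr.
have -> : c + kap * b - (c + kap * a) = kap * (b - a) by ring.
set S := \sum_(_ <= _ < _) _; rewrite mulrA; congr (_ * _).
have -> : kap * (b - a) / n%:R / 2 / kap = (b - a) / n%:R / 2 * (kap / kap) by ring.
by rewrite divff // mulr1.
Qed.

Lemma derivable_quot h1 h2 z : h2 z != 0 ->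
  derivable h1 z 1 -> derivable h2 z 1 -> derivable (fun w => h1 w / h2 w) z 1.
Proof. by move=> h0 d1 d2; exact: (derivableM d1 (derivableV h0 d2)). Qed.

Lemma derivable_sub_cst c z : derivable (fun w : C => w - c) z 1.
Proof.
by apply: (@derivableB _ _ _ id (cst c)); [exact: derivable_id|exact: derivable_cst].
Qed.

(** A crude Cauchy estimate. The triangle sums of [(h z - h c) / (z - c)] over the
    four triangles joining [c] to the sides of the square tend to 0, and the sums
    over the inner edges cancel. Hence [h c] times the contour sum of
    [1 / (z - c)], of modulus at least 4, is approximately the contour sum of
    [h z / (z - c)], of modulus at most [8 * M]. *)
Lemma center_le_twice h c (s M : R) : 0 < s ->
  (forall z, nm (z - c) <= 2 * s -> derivable h z 1) ->
  (forall z, s <= nm (z - c) <= 2 * s -> nm (h z) <= M) ->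
  nm (h c) <= 2 * M.
Proof.
move=> s0 Hh HM.
pose F z := (h z - h c) / (z - c).
have cc : nm (c - c) <= 2 * s by rewrite subrr nm0; lra.
have [l Hl] := (derivableCP _ _).1 (Hh _ cc).
have [d d0 Hd] := Hl 1 ltr01.
have FB w : nm (w - c) <= d / 2 -> nm (F w) <= nm l + 1.
  move=> hw; have [->|wc] := eqVneq w c.
    by rewrite /F !subrr mul0r nm0; have := nm_ge0 l; lra.
  have w0 : 0 < nm (w - c) by rewrite nm_gt0 subr_eq0.
  rewrite /F nmM nmV ler_pdivrMr //.
  have hd : nm (w - c) < d by lra.
  have := Hd w hd; have := nmD (h w - h c - l * (w - c)) (l * (w - c)).
  rewrite subrK nmM; lra.
have Fd z : nm (z - c) <= 2 * s -> z != c -> derivable F z 1.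
  move=> hz zc; apply: derivable_quot; first by rewrite subr_eq0.
    by apply: (@derivableB _ _ _ h (cst (h c))); [exact: Hh|exact: derivable_cst].
  exact: derivable_sub_cst.
have d20 : 0 < d / 2 by rewrite divr_gt0.
have nlo : nm sq_lo <= 2.
  by apply: le_trans (nm_le_ReIm _) _; rewrite /sq_lo /= normrN normr1; lra.
have nhi : nm sq_hi <= 2.
  by apply: le_trans (nm_le_ReIm _) _; rewrite /sq_hi /= normr1; lra.
have T kap : nm kap = s -> tends0 (fun k => tri k F c (c + kap * sq_lo) (c + kap * sq_hi)).
  move=> ks; have k0 : kap != 0 by rewrite -nm_gt0 ks.
  apply: (@tri_apex R F c kap^-1 (2 * s) 1 (nm l + 1) (d / 2)) => //.
  - by rewrite nmM ks mulrC ler_pM2r.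
  - by rewrite nmM ks mulrC ler_pM2r.
  - by rewrite mulrA mulVf // mul1r.
  - by rewrite mulrA mulVf // mul1r.
pose k1 : C := (s%:C)%C; pose k2 : C := imu * k1.
have nk1 : nm k1 = s by rewrite nm_real gtr0_norm.
have nk2 : nm k2 = s by rewrite nmM nm_imu mul1r.
have nk3 : nm (- k1) = s by rewrite nmN.
have nk4 : nm (- k2) = s by rewrite nmN.
have side n kap : (0 < n)%N -> nm kap = s ->
    trap n F (c + kap * sq_lo) (c + kap * sq_hi) =
    trap n (fun z => h z / (z - c)) (c + kap * sq_lo) (c + kap * sq_hi)
    - h c * trap n (fun z => z^-1) sq_lo sq_hi.
  move=> n0 ks; have k0 : kap != 0 by rewrite -nm_gt0 ks.
  rewrite -(side_scale n c sq_lo sq_hi k0) -mulNr -trapZ -trapD.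
  apply: eq_trap => // k _; rewrite /F; ring.
have bnd n kap : (0 < n)%N -> nm kap = s ->
    nm (trap n (fun z => h z / (z - c)) (c + kap * sq_lo) (c + kap * sq_hi)) <= 2 * M.
  move=> n0 ks.
  have -> : 2 * M = (M / s) * nm (c + kap * sq_hi - (c + kap * sq_lo)).
    have -> : c + kap * sq_hi - (c + kap * sq_lo) = kap * (sq_hi - sq_lo) by ring.
    rewrite hi_sub_lo !nmM ks nm_imu nm_nat; field; by rewrite gt_eqF.
  apply: trap_bound => // k kn.
  have /andP[g1 g2] := nm_side n0 kn.
  have E : nm (seg n (c + kap * sq_lo) (c + kap * sq_hi) k - c) =
      s * nm (seg n sq_lo sq_hi k).
    by rewrite seg_affine addrAC subrr add0r nmM ks.
  have g3 : s <= s * nm (seg n sq_lo sq_hi k) by rewrite ler_peMr // ltW.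
  have g4 : s * nm (seg n sq_lo sq_hi k) <= 2 * s by rewrite mulrC ler_pM2r.
  have hM : nm (h (seg n (c + kap * sq_lo) (c + kap * sq_hi) k)) <= M.
    by apply: HM; rewrite E g3 g4.
  rewrite nmM nmV E; apply: ler_pM; rewrite ?nm_ge0 ?invr_ge0 //.
    by rewrite (le_trans _ g3) // ltW.
  by rewrite lef_pV2 ?posrE // (lt_le_trans _ g3).
apply/ler_addgt0Pr => e e0.
have := tends0D (tends0D (T _ nk1) (T _ nk2)) (tends0D (T _ nk3) (T _ nk4)).
move=> /(_ e e0) [k /(_ k (leqnn k))].
have n0 : (0 < 2 ^ k)%N by rewrite expn_gt0.
have cancel kap : trap (2 ^ k) F (c + kap * sq_hi) c =
    - trap (2 ^ k) F c (c + (imu * kap) * sq_lo).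
  by rewrite trap_rev // mulrAC imu_lo mulrC.
have E3 : imu * k2 = - k1 by rewrite /k2 mulrA imu2 mulN1r.
have E4 : imu * (- k1) = - k2 by rewrite mulrN.
have E5 : imu * (- k2) = k1 by rewrite mulrN E3 opprK.
rewrite /tri !cancel -/k2 E3 E4 E5 !side //.
set K := trap _ (fun z => z^-1) _ _.
set A := trap _ _ (c + k1 * _) _; set B := trap _ _ (c + k2 * _) _.
set D := trap _ _ (c + - k1 * _) _; set G := trap _ _ (c + - k2 * _) _.
set X := (X in nm X) => hX.
have EX : 4 * (h c * K) = (A + B) + (D + G) - X by rewrite /X; ring.
have : nm (4 * (h c * K)) <= 8 * M + e.
  rewrite EX; apply: le_trans (nmDB _ _) _.
  have := nmD (A + B) (D + G); have := nmD A B; have := nmD D G.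
  have := bnd _ _ n0 nk1; have := bnd _ _ n0 nk2.
  have := bnd _ _ n0 nk3; have := bnd _ _ n0 nk4.
  rewrite -/A -/B -/D -/G; lra.
rewrite (nmM 4) (nmM (h c)) nm_nat.
have K1 : 1 <= nm K := side_kernel n0.
have := ler_wpM2l (nm_ge0 (h c)) K1; rewrite mulr1.
move: (nm (h c) * nm K) (nm (h c)) => y x; lra.
Qed.

End MaxModulus.

(** * The maximum modulus principle *)

Section Removable.
Variable R : realType.
Local Notation C := (Cplx R).
Implicit Types (a b c z w : C) (h : C -> C).

(** Otherwise [(x / y) ^ n] would grow at least linearly in [n]. *)
Lemma le_of_le_expn (x y d K : R) : 0 <= x -> 0 <= y -> 0 < d ->
  (forall n, x ^+ n * d <= K * y ^+ n) -> x <= y.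
Proof.
move=> x0 y0 d0 H; rewrite leNgt; apply/negP => yx.
pose t := (x + y) / 2; have ty : y <= t by rewrite /t; lra.
have tx : t < x by rewrite /t; lra.
have t0 : 0 < t by rewrite /t; lra.
have K0 : 0 <= K by have := H 0; rewrite !expr0; lra.
pose q := x / t - 1.
have q0 : 0 < q by rewrite subr_gt0 ltr_pdivlMr // mul1r.
have bern n : 1 + n%:R * q <= (x / t) ^+ n.
  elim: n => [|n IH]; first by rewrite mul0r addr0 expr0.
  have -> : x / t = 1 + q by rewrite /q; ring.
  move: IH; have -> : x / t = 1 + q by rewrite /q; ring.
  rewrite exprS -natr1 => IH.
  have q1 : 0 <= 1 + q by lra.
  have n0 : 0 <= n%:R * q * q by rewrite !mulr_ge0 // ltW.
  have := ler_wpM2l q1 IH; lra.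
have H' n : (x / t) ^+ n * d <= K.
  rewrite expr_div_n mulrAC ler_pdivrMr ?exprn_gt0 //.
  apply: le_trans (H n) _; apply: ler_wpM2l => //.
  by rewrite lerXn2r ?nnegrE ?(ltW t0).
pose n := (Num.truncn (K / d / q)).+1.
have hn : K / d / q < n%:R by exact: truncnS_gt.
move: hn; rewrite ltr_pdivrMr // ltr_pdivrMr // => hn.
have := H' n; have := ler_wpM2r (ltW d0) (bern n); lra.
Qed.

Lemma derivable_near h1 h2 z (d : R) : 0 < d ->
  (forall w, nm (w - z) < d -> h1 w = h2 w) ->
  derivable h1 z 1 -> derivable h2 z 1.
Proof.
move=> d0 H /(derivableCP _ _).1 [l Hl]; apply/(derivableCP _ _).2.
exists l => e e0; have [d' d'0 Hd] := Hl e e0.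
exists (Num.min d d'); first by rewrite lt_min d0.
move=> w; rewrite lt_min => /andP[h3 h4].
by rewrite -!H ?subrr ?nm0 //; exact: Hd.
Qed.

Lemma continuous_near h1 h2 z (d : R) : 0 < d ->
  (forall w, nm (w - z) < d -> h1 w = h2 w) ->
  {for z, continuous h1} -> {for z, continuous h2}.
Proof.
move=> d0 H /(continuousCP _ _).1 Hl; apply/(continuousCP _ _).2 => e e0.
have [d' d'0 Hd] := Hl e e0.
exists (Num.min d d'); first by rewrite lt_min d0.
move=> w; rewrite lt_min => /andP[h3 h4].
by rewrite -!H ?subrr ?nm0 //; exact: Hd.
Qed.

(** The difference quotient of the product at a zero [z] of [p] is [h w] times that
    of [p], so that [h] need only be continuous at [z]. *)
Lemma derivable_mul_zero h p z : {for z, continuous h} -> derivable p z 1 ->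
  p z = 0 -> derivable (fun w => h w * p w) z 1.
Proof.
move=> /(continuousCP _ _).1 Hh /(derivableCP _ _).1 [l Hl] pz.
apply/(derivableCP _ _).2; exists (h z * l) => e e0.
pose A := nm (h z) + 1; have A0 : 0 < A by have := nm_ge0 (h z); rewrite /A; lra.
pose e1 := e / (2 * A); have e10 : 0 < e1 by rewrite divr_gt0 // mulr_gt0.
pose L := nm l + 1; have L0 : 0 < L by have := nm_ge0 l; rewrite /L; lra.
pose e2 := Num.min 1 (e / (2 * L)).
have e20 : 0 < e2 by rewrite lt_min ltr01 divr_gt0 // mulr_gt0.
have [d1 d10 H1] := Hl _ e10; have [d2 d20 H2] := Hh _ e20.
exists (Num.min d1 d2); first by rewrite lt_min d10.
move=> w; rewrite lt_min => /andP[h1 h2].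
have := H1 w h1; rewrite pz subr0 mulr0 subr0 => h3.
have := H2 w h2; rewrite lt_min => /andP[h4 h5].
have -> : h w * p w - h z * l * (w - z) =
   h w * (p w - l * (w - z)) + (h w - h z) * (l * (w - z)) by ring.
apply: le_trans (nmD _ _) _; rewrite !nmM.
have h6 : nm (h w) <= A.
  by have := nmD (h w - h z) (h z); rewrite subrK /A; lra.
have h7 : nm (h w) * nm (p w - l * (w - z)) <= A * (e1 * nm (w - z)).
  by apply: ler_pM; rewrite ?nm_ge0.
have h8 : nm (h w - h z) * (nm l * nm (w - z)) <= e / (2 * L) * (L * nm (w - z)).
  apply: ler_pM; rewrite ?mulr_ge0 ?nm_ge0 ?(ltW h5) //.
  by apply: ler_wpM2r; rewrite ?nm_ge0 // /L; lra.
have h9 : A * (e1 * nm (w - z)) = e / 2 * nm (w - z).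
  rewrite /e1; field; by rewrite gt_eqF.
have h10 : e / (2 * L) * (L * nm (w - z)) = e / 2 * nm (w - z).
  field; by rewrite gt_eqF.
lra.
Qed.

Lemma derivable_prod_sub (exc : seq C) z :
  derivable (fun w : C => \prod_(e <- exc) (w - e)) z 1.
Proof.
elim: exc => [|e exc IH].
  under eq_fun do rewrite big_nil; exact: derivable_cst.
under eq_fun do rewrite big_cons.
exact: derivableM (@derivable_sub_cst R e z) IH.
Qed.

Lemma continuous_expn h z k : {for z, continuous h} ->
  {for z, continuous (fun w => h w ^+ k)}.
Proof.
move=> H; elim: k => [|k IH].
  have -> : (fun w => h w ^+ 0) = cst 1 by apply/funext => w; rewrite expr0.
  exact: cst_continuous.
have -> : (fun w => h w ^+ k.+1) = (fun w => h w * h w ^+ k).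
  by apply/funext => w; rewrite exprS.
exact: (continuousM H IH).
Qed.

Lemma derivable_expn h z k : derivable h z 1 ->
  derivable (fun w => h w ^+ k) z 1.
Proof.
move=> H; elim: k => [|k IH].
  under eq_fun do rewrite expr0; exact: derivable_cst.
under eq_fun do rewrite exprS; exact: derivableM H IH.
Qed.

(** The constant 2 of [center_le_twice] disappears by applying it to the powers
    of [h]; multiplying these powers by a fixed polynomial vanishing at the
    exceptional points restores differentiability there at no asymptotic cost. *)
Lemma max_modulus_off h c (s M : R) (exc : seq C) : 0 < s ->
  (forall z, nm (z - c) <= 2 * s -> {for z, continuous h}) ->
  (forall z, nm (z - c) <= 2 * s -> z \notin exc -> derivable h z 1) ->
  (forall z, s <= nm (z - c) <= 2 * s -> nm (h z) <= M) ->
  c \notin exc -> nm (h c) <= M.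
Proof.
move=> s0 Hc Hd HM cexc.
pose P z : C := \prod_(e <- exc) (z - e).
pose Q : R := \prod_(e <- exc) (2 * s + nm (c - e)).
have M0 : 0 <= M.
  apply: le_trans (nm_ge0 _) (HM (c + (s%:C)%C) _).
  by rewrite addrAC subrr add0r nm_real gtr0_norm // lexx; lra.
have Pc : 0 < nm (P c).
  rewrite nm_gt0 prodf_seq_neq0; apply/allP => e he; rewrite subr_eq0.
  by apply/implyP => _; apply: contraNneq cexc => ->.
apply: (@le_of_le_expn _ _ (nm (P c)) (2 * Q)); rewrite ?nm_ge0 // => n.
rewrite -nmX -nmM.
have -> : 2 * Q * M ^+ n = 2 * (M ^+ n * Q) by ring.
have T := @center_le_twice R (fun z => h z ^+ n * P z) c s (M ^+ n * Q) s0.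
apply: T => z hz.
  have [ze|ze] := boolP (z \in exc).
    apply: (@derivable_mul_zero (fun w => h w ^+ n) P z).
    - by apply: continuous_expn; exact: Hc.
    - exact: derivable_prod_sub.
    - by apply/eqP; rewrite prodf_seq_eq0; apply/hasP; exists z; rewrite // subrr eqxx.
  exact: derivableM (@derivable_expn h z n (Hd z hz ze)) (@derivable_prod_sub exc z).
have /andP[_ hz2] := hz.
rewrite nmM nmX; apply: ler_pM; rewrite ?exprn_ge0 ?nm_ge0 //.
  by rewrite lerXn2r ?nnegrE ?nm_ge0 ?HM.
rewrite nm_prod /Q; apply: ler_prod => e _; rewrite nm_ge0 /=.
have := nm_tri z e c; lra.
Qed.

Lemma separation_radius c (exc : seq C) (d : R) : 0 < d ->
  exists2 d' : R, 0 < d' & d' <= d /\ 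
    forall e, e \in exc -> e != c -> d' <= nm (e - c).
Proof.
move=> d0; elim: exc => [|e exc [d' d'0 [d'd IH]]]; first by exists d.
have [->|ec] := eqVneq e c.
  exists d' => //; split=> // x; rewrite inE => /orP[/eqP -> /eqP//|]; exact: IH.
exists (Num.min d' (nm (e - c))); first by rewrite lt_min d'0 nm_gt0 subr_eq0.
split; first by rewrite ge_min d'd.
move=> x; rewrite inE => /orP[/eqP -> _|xe xc]; rewrite ge_min ?lexx ?orbT //.
by rewrite IH.
Qed.

Lemma avoid_near c (exc : seq C) (d : R) : 0 < d ->
  exists2 c', nm (c' - c) < d & c' \notin exc.
Proof.
move=> d0; have [d' d'0 [d'd Hd]] := separation_radius c exc d0.
have E : nm (c + ((d' / 2)%:C)%C - c) = d' / 2.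
  by rewrite addrAC subrr add0r nm_real gtr0_norm // divr_gt0.
exists (c + ((d' / 2)%:C)%C); first by rewrite E; lra.
apply/negP => /Hd; rewrite E -subr_eq0 -nm_eq0 E => /(_ _) H.
have : d' <= d' / 2 by apply: H; rewrite gt_eqF // divr_gt0.
lra.
Qed.

(** The centre may be exceptional too: apply the previous lemma at nearby centres
    that are not, at the price of a thicker annulus. *)
Lemma max_modulus h c (s M : R) (exc : seq C) : 0 < s ->
  (forall z, nm (z - c) <= 4 * s -> {for z, continuous h}) ->
  (forall z, nm (z - c) <= 4 * s -> z \notin exc -> derivable h z 1) ->
  (forall z, s <= nm (z - c) <= 4 * s -> nm (h z) <= M) ->
  nm (h c) <= M.
Proof.
move=> s0 Hc Hd HM; apply/ler_addgt0Pr => e e0.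
have cc : nm (c - c) <= 4 * s by rewrite subrr nm0; lra.
have [d d0 H] := (continuousCP _ _).1 (Hc c cc) e e0.
have d1 : 0 < Num.min d (s / 2) by rewrite lt_min d0 divr_gt0.
have [c' ] := avoid_near c exc d1; rewrite lt_min => /andP[h1 h2] c'e.
have ball z : nm (z - c') <= 2 * (3 / 2 * s) -> nm (z - c) <= 4 * s.
  by move=> hz; have := nm_tri z c c'; lra.
have h3 : nm (h c') <= M.
  apply: (@max_modulus_off h c' (3 / 2 * s) M exc) => //.
  - by rewrite mulr_gt0 // divr_gt0.
  - by move=> z /ball; exact: Hc.
  - by move=> z /ball; exact: Hd.
  - move=> z /andP[h4 h5]; apply: HM; rewrite (ball _ h5) andbT.
    by have := nm_tri z c' c; rewrite (nmB c c'); lra.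
have := H c' h1; have := nmD (h c - h c') (h c'); rewrite subrK (nmB (h c)); lra.
Qed.

End Removable.

(** * Removable singularities and division by a zero *)

Section Division.
Variable R : realType.
Local Notation C := (Cplx R).
Implicit Types (a b c z w : C) (h : C -> C).

(** The difference quotient of [h] based at [w], completed by [l], which is meant to
    be the derivative of [h] at [w]. *)
Definition slope h w (l : C) z : C := if z == w then l else (h z - h w) / (z - w).

Lemma slope_derivable h w l z : z != w -> derivable h z 1 ->
  derivable (slope h w l) z 1.
Proof.
move=> zw dh; have zw0 : 0 < nm (z - w) by rewrite nm_gt0 subr_eq0.
apply: (@derivable_near R (fun z => (h z - h w) / (z - w)) _ z (nm (z - w)) zw0).
  move=> t ht; rewrite /slope; case: eqP => // tw; move: ht.
  by rewrite tw nmB ltxx.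
have d1 : derivable (fun t => h t - h w) z 1.
  exact: (@derivableB _ _ _ h (cst (h w)) z 1 dh (@derivable_cst _ _ _ _ _ _)).
have zw1 : z - w != 0 by rewrite subr_eq0.
exact: (@derivable_quot R (fun t => h t - h w) (fun t => t - w) z zw1 d1
  (@derivable_sub_cst R w z)).
Qed.

Lemma slope_continuous_at h w l :
  (forall e : R, 0 < e -> exists2 d : R, 0 < d &
    forall t, nm (t - w) < d -> nm (h t - h w - l * (t - w)) <= e * nm (t - w)) ->
  {for w, continuous (slope h w l)}.
Proof.
move=> Hl; apply/(continuousCP _ _).2 => e e0.
have e20 : 0 < e / 2 by rewrite divr_gt0.
have [d d0 Hd] := Hl _ e20; exists d => // t ht.
rewrite /slope eqxx; case: eqVneq => [_|tw]; first by rewrite subrr nm0.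
have t0 : 0 < nm (t - w) by rewrite nm_gt0 subr_eq0.
have -> : (h t - h w) / (t - w) - l = (h t - h w - l * (t - w)) / (t - w).
  field; by rewrite subr_eq0.
rewrite nmM nmV ltr_pdivrMr //; apply: le_lt_trans (Hd t ht) _.
by rewrite ltr_pM2r //; lra.
Qed.

(** For [w] and [w'] close to [z0], the difference of the slopes of [h] based at [w]
    and [w'] is small on an annulus around [z0], since [z - w] and [z - w'] are
    bounded away from 0 there. The maximum modulus principle, which tolerates the
    exceptional points [z0], [w] and [w'], transports this smallness to [z0]: the
    difference quotients of [h] at [z0] are Cauchy. *)
Lemma removable_singularity h z0 (r : R) : 0 < r ->
  {for z0, continuous h} ->
  (forall z, nm (z - z0) < r -> z != z0 -> derivable h z 1) ->
  derivable h z0 1.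
Proof.
move=> r0 Hc Hd.
have Hc' := (continuousCP _ _).1 Hc.
have [d0 d00 Hd0] := Hc' 1 ltr01.
pose s := Num.min r d0 / 8.
have m0 : 0 < Num.min r d0 by rewrite lt_min r0.
have s0 : 0 < s by rewrite divr_gt0.
have s8 : 8 * s = Num.min r d0 by rewrite /s; lra.
have sr : 8 * s <= r by rewrite s8 ge_min lexx.
have sd : 8 * s <= d0 by rewrite s8 ge_min lexx orbT.
pose B := nm (h z0) + 1.
have B1 : 1 <= B by rewrite /B; have := nm_ge0 (h z0); lra.
have HB z : nm (z - z0) <= 4 * s -> nm (h z) <= B.
  move=> hz; have hz' : nm (z - z0) < d0 by lra.
  by have := Hd0 z hz'; have := nmD (h z - h z0) (h z0); rewrite subrK /B; lra.
have Hcont z : nm (z - z0) <= 4 * s -> {for z, continuous h}.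
  move=> hz; have [->//|zz] := eqVneq z z0.
  by apply: derivable_continuousC; apply: Hd; [lra|].
pose q w := (h w - h z0) / (w - z0).
have est w w' : 0 < nm (w - z0) -> nm (w - z0) <= s / 2 ->
    0 < nm (w' - z0) -> nm (w' - z0) <= s / 2 ->
    nm (q w - q w') <=
    (2 * B * nm (w - w') + nm (h w' - h w) * (5 * s)) / (s / 2 * (s / 2)).
  move=> w0 ws w'0 w's.
  have wz : w != z0 by rewrite -subr_eq0 -nm_gt0.
  have w'z : w' != z0 by rewrite -subr_eq0 -nm_gt0.
  have [l Hl] : exists l, forall e : R, 0 < e -> exists2 d : R, 0 < d &
    forall t, nm (t - w) < d -> nm (h t - h w - l * (t - w)) <= e * nm (t - w).
    by apply: (derivableCP _ _).1; apply: Hd; [lra|].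
  have [l' Hl'] : exists l, forall e : R, 0 < e -> exists2 d : R, 0 < d &
    forall t, nm (t - w') < d -> nm (h t - h w' - l * (t - w')) <= e * nm (t - w').
    by apply: (derivableCP _ _).1; apply: Hd; [lra|].
  pose D z := slope h w l z - slope h w' l' z.
  have DE z : z != w -> z != w' -> D z =
     ((h z - h w) * (w - w') + (h w' - h w) * (z - w)) / ((z - w) * (z - w')).
    move=> zw zw'; rewrite /D /slope (negbTE zw) (negbTE zw'); field.
    by rewrite !subr_eq0 zw zw'.
  have -> : q w - q w' = D z0.
    rewrite DE 1?eq_sym // /q; field.
    by rewrite !subr_eq0 wz w'z ![z0 == _]eq_sym wz w'z.
  have slope_cont v m z : nm (z - z0) <= 4 * s ->
    (forall e : R, 0 < e -> exists2 d : R, 0 < d &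
    forall t, nm (t - v) < d -> nm (h t - h v - m * (t - v)) <= e * nm (t - v)) ->
    {for z, continuous (slope h v m)}.
    move=> hz Hm; have [->|zv] := eqVneq z v; first exact: slope_continuous_at.
    apply: (@continuous_near R (fun z => (h z - h v) / (z - v)) _ z (nm (z - v))).
    - by rewrite nm_gt0 subr_eq0.
    - move=> t ht; rewrite /slope; case: eqP => // tw; move: ht.
      by rewrite tw nmB ltxx.
    - have c1 : {for z, continuous (fun t => h t - h v)}.
        exact: (@continuousB _ _ _ h (cst (h v)) z (Hcont z hz) (@cst_continuous _ _ _ _)).
      have c2 : {for z, continuous (fun t => (t - v)^-1)}.
        apply: (@continuousV _ _ (fun t => t - v)); first by rewrite subr_eq0.
        by apply: derivable_continuousC; exact: derivable_sub_cst.
      exact: (continuousM c1 c2).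
  have MM := @max_modulus R D z0 s _ [:: z0; w; w'] s0.
  apply: MM.
  - move=> z hz.
    exact: (continuousB (slope_cont w l z hz Hl) (slope_cont w' l' z hz Hl')).
  - move=> z hz; rewrite !inE !negb_or => /and3P[z1 z2 z3].
    have hz' : nm (z - z0) < r by lra.
    have dz := Hd z hz' z1.
    exact: (derivableB (@slope_derivable h w l z z2 dz) (@slope_derivable h w' l' z z3 dz)).
  move=> z /andP[h1 h2].
  have zw : s / 2 <= nm (z - w) by have := nm_tri z z0 w; lra.
  have zw' : s / 2 <= nm (z - w') by have := nm_tri z z0 w'; lra.
  have s20 : 0 < s / 2 by rewrite divr_gt0.
  have zw0 : z != w by rewrite -subr_eq0 -nm_gt0 (lt_le_trans s20).
  have zw'0 : z != w' by rewrite -subr_eq0 -nm_gt0 (lt_le_trans s20).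
  rewrite DE // nmM nmV (nmM (z - w)).
  have p1 : 0 < nm (z - w) := lt_le_trans s20 zw.
  have p2 : 0 < nm (z - w') := lt_le_trans s20 zw'.
  have P : (nm (z - w) * nm (z - w'))^-1 <= (s / 2 * (s / 2))^-1.
    rewrite lef_pV2 ?posrE; [|exact: mulr_gt0|exact: mulr_gt0].
    by apply: ler_pM => //; exact: ltW.
  apply: ler_pM => //; first exact: nm_ge0.
    by rewrite invr_ge0 mulr_ge0 ?nm_ge0.
  apply: le_trans (nmD _ _) _; rewrite !nmM; apply: lerD; apply: ler_pM; rewrite ?nm_ge0 //.
    have := nmDB (h z) (h w); have := HB z h2.
    have hw4 : nm (w - z0) <= 4 * s by lra.
    have := HB w hw4; lra.
  have := nm_tri z w z0; rewrite (nmB z0 w); lra.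
(* the radius balances the two terms of [est], each of them made at most half of
   [e * (s / 2) ^ 2] *)
have cauchy e : 0 < e -> exists2 d : R, 0 < d & forall w w',
    0 < nm (w - z0) -> nm (w - z0) < d -> 0 < nm (w' - z0) -> nm (w' - z0) < d ->
    nm (q w - q w') <= e.
  move=> e0.
  have e10 : 0 < e * s / 80 by rewrite divr_gt0 // mulr_gt0.
  have [d1 d10 H1] := Hc' _ e10.
  have B0 : 0 < 32 * B by lra.
  have e20 : 0 < e * (s * s) / (32 * B) by rewrite divr_gt0 // !mulr_gt0.
  pose d2 := e * (s * s) / (32 * B).
  exists (Num.min (s / 2) (Num.min d1 d2)).
    by rewrite !lt_min d10 e20 divr_gt0.
  move=> w w' w0; rewrite !lt_min => /and3P[a1 a2 a3] w'0 /and3P[b1 b2 b3].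
  apply: le_trans (est w w' w0 (ltW a1) w'0 (ltW b1)) _.
  rewrite ler_pdivrMr; last by rewrite !mulr_gt0 ?invr_gt0.
  have g1 : nm (w - w') <= 2 * d2 by have := nm_tri w w' z0; rewrite (nmB z0 w'); lra.
  have g2 : nm (h w' - h w) <= e * s / 40.
    have := nm_tri (h w') (h w) (h z0); rewrite (nmB (h z0) (h w)).
    have := H1 w a2; have := H1 w' b2; lra.
  have B2 : 0 <= 2 * B by lra.
  have s5 : 0 <= 5 * s by lra.
  have := ler_wpM2l B2 g1; have := ler_wpM2r s5 g2.
  have -> : 2 * B * (2 * d2) = e * (s * s) / 8 by rewrite /d2; field; rewrite gt_eqF //; lra.
  have -> : e * s / 40 * (5 * s) = e * (s * s) / 8 by field.
  have -> : e * (s / 2 * (s / 2)) = e * (s * s) / 8 + e * (s * s) / 8 by field.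
  lra.
pose u (k : nat) : C := z0 + ((s / 2 ^+ k)%:C)%C.
have nu k : nm (u k - z0) = s / 2 ^+ k.
  by rewrite addrAC subrr add0r nm_real gtr0_norm // divr_gt0 // exprn_gt0.
have u0 k : 0 < nm (u k - z0) by rewrite nu divr_gt0 // exprn_gt0.
have umono i j : (i <= j)%N -> nm (u j - z0) <= nm (u i - z0).
  move=> ij; rewrite !nu ler_pM2l // lef_pV2 ?posrE ?exprn_gt0 //.
  by rewrite ler_weXn2l // ler1n.
have usmall d : 0 < d -> exists N, forall k, (N <= k)%N -> nm (u k - z0) < d.
  move=> dd0; have d20 : 0 < d / 2 by rewrite divr_gt0.
  have [N HN] := half_powers_vanish s d20; exists N => k /umono.
  rewrite [X in _ <= X -> _]nu; lra.
have [l Hl] : exists l, forall e, 0 < e -> exists N, forall i, (N <= i)%N ->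
    nm (q (u i) - l) <= e.
  apply: complete_complex => e e0; have [d dd0 H] := cauchy e e0.
  by have [N HN] := usmall d dd0; exists N => i j hi hj; apply: H; rewrite ?u0 ?HN.
apply/(derivableCP _ _).2; exists l => e e0.
have e20 : 0 < e / 2 by rewrite divr_gt0.
have [d dd0 H] := cauchy _ e20; exists d => // w hw.
have [->|wz] := eqVneq w z0; first by rewrite !subrr mulr0 subrr nm0 mulr0.
have w0 : 0 < nm (w - z0) by rewrite nm_gt0 subr_eq0.
have [N1 H1] := usmall d dd0; have [N2 H2] := Hl _ e20.
have := H1 (N1 + N2)%N (leq_addr _ _); have := H2 (N1 + N2)%N (leq_addl _ _).
move: (N1 + N2)%N => k h1 h2.
have h3 := H w (u k) w0 hw (u0 k) h2.
have -> : h w - h z0 - l * (w - z0) = (q w - l) * (w - z0).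
  rewrite /q; field; by rewrite subr_eq0.
rewrite nmM ler_wpM2r ?nm_ge0 //.
have := nm_tri (q w) l (q (u k)); lra.
Qed.

(** The quotient is the slope of [h] at [z1], where its singularity is removable. *)
Lemma holomorphic_divide (E : set C) h z1 : open E -> E z1 ->
  (forall z, E z -> derivable h z 1) -> h z1 = 0 ->
  exists2 g, (forall z, E z -> derivable g z 1) & forall z, h z = (z - z1) * g z.
Proof.
move=> Eo E1 Hh h1.
have [l Hl] := (derivableCP _ _).1 (Hh z1 E1).
have dg z : E z -> z != z1 -> derivable (slope h z1 l) z 1.
  by move=> Ez zz; apply: slope_derivable => //; exact: Hh.
exists (slope h z1 l) => z.
  have [-> _|zz Ez] := eqVneq z z1; last exact: dg.
  have [d d0 Hd] := (nbhsCP _ _).1 (open_nbhs_nbhs (conj Eo E1)).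
  apply: (@removable_singularity _ _ d d0).
    exact: slope_continuous_at.
  by move=> w hw wz; apply: dg => //; exact: Hd.
rewrite /slope; case: eqVneq => [->|zz]; first by rewrite subrr mul0r h1.
by rewrite h1 subr0 mulrC mulfVK // subr_eq0.
Qed.

End Division.

(** * Counting zeros from growth on an annulus *)

Section ZeroCount.
Variable R : realType.
Local Notation C := (Cplx R).
Implicit Types (a b c z w : C).

(** At distance at least [2 * s] from 0, points of the disk of radius [s] are seen as
    if they were 0, up to a factor 2. *)
Lemma prod_sub_bounds (zs : seq C) (s : R) z :
  (forall e, e \in zs -> nm e < s) -> 2 * s <= nm z ->
  (nm z / 2) ^+ size zs <= nm (\prod_(e <- zs) (z - e)) <= (2 * nm z) ^+ size zs.
Proof.
move=> Hs hz; elim: zs Hs => [|e zs IH] Hs; first by rewrite big_nil nm1 !expr0 lexx.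
have /andP[IH1 IH2] := IH (fun x hx => Hs x (@mem_behead _ (e :: zs) x hx)).
have he : nm e < s by apply: Hs; rewrite inE eqxx.
have e0 := nm_ge0 e; have z0 := nm_ge0 z.
rewrite big_cons nmM /= !exprS.
have h1 : nm z / 2 <= nm (z - e).
  by have := nmD (z - e) e; rewrite subrK; lra.
have h2 : nm (z - e) <= 2 * nm z by have := nmDB z e; lra.
apply/andP; split; apply: ler_pM; rewrite ?nm_ge0 ?exprn_ge0 ?divr_ge0 //.
Qed.

Section Count.
Variables (E : set C) (H : C -> C) (N : nat) (s lam : R).
(* The ratio of the radii must beat the constants [2 ^ N] lost in
   [prod_sub_bounds]. *)
Let q : R := 4 ^+ (N + 3).
Hypothesis Eo : open E.
Hypothesis HE : forall z, E z -> derivable H z 1.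
Hypothesis s0 : 0 < s.
Hypothesis lam0 : 0 < lam.
Hypothesis Edisk : forall z, nm z <= 12 * q * s -> E z.
Hypothesis Hann : forall z, s <= nm z <= 12 * q * s ->
  lam * nm z ^+ N <= nm (H z) <= 4 * lam * nm z ^+ N.

Let factors (zs : seq C) (g : C -> C) :=
  [/\ forall e, e \in zs -> nm e < s,
      forall z, E z -> derivable g z 1
    & forall z, H z = \prod_(e <- zs) (z - e) * g z].

Let q1 : 1 <= q. Proof. by rewrite exprn_ege1 // ler1n. Qed.
(* The principle is applied on a large annulus centred at this point rather than
   at 0, because the growth of [H] is known only outside the disk of radius [s]. *)
Let p : C := ((2 * s)%:C)%C.
Let nmp : nm p = 2 * s. Proof. by rewrite nm_real gtr0_norm // mulr_gt0. Qed.

Let around_p z : 4 * q * s <= nm (z - p) <= 2 * (4 * q * s) ->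
  [/\ 2 * s <= nm z, 2 * q * s <= nm z & nm z <= 12 * q * s].
Proof.
move=> /andP[h1 h2]; have qs := ler_wpM2r (ltW s0) q1.
have g1 : nm (z - p) <= nm z + 2 * s by rewrite -nmp nmDB.
have g2 : nm z <= nm (z - p) + 2 * s by have := nmD (z - p) p; rewrite subrK nmp.
have := s0; split; lra.
Qed.

Let disk_p z : nm (z - p) <= 2 * (4 * q * s) -> nm z <= 12 * q * s.
Proof.
move=> h2; have qs := ler_wpM2r (ltW s0) q1.
have g2 : nm z <= nm (z - p) + 2 * s by have := nmD (z - p) p; rewrite subrK nmp.
have := s0; lra.
Qed.

(** Once [N.+1] zeros are split off, the cofactor [g] is comparable to
    [lam / |z|] outside the small disk: it is much smaller far away than at [p],
    against the maximum modulus principle. *)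
Let factors_le zs g : factors zs g -> size zs <> N.+1.
Proof.
move=> [Hs Hg HH] szs.
have s40 : 0 < 4 * q * s by rewrite !mulr_gt0 // (lt_le_trans ltr01).
have qs0 : 0 < 2 * q * s by rewrite !mulr_gt0 // (lt_le_trans ltr01).
pose M := 4 * lam * 2 ^+ N.+1 / (2 * q * s).
have bnd : nm (g p) <= M.
  apply: (@max_modulus_off R g p (4 * q * s) M [::] s40).
  - by move=> z hz; apply: derivable_continuousC; apply: Hg; apply: Edisk; exact: disk_p.
  - by move=> z hz _; apply: Hg; apply: Edisk; exact: disk_p.
  - move=> z hz; have [z1 z2 z3] := around_p hz.
    have zs' : s <= nm z by have := s0; lra.
    have /andP[_ hH] : lam * nm z ^+ N <= nm (H z) <= 4 * lam * nm z ^+ N.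
      by apply: Hann; rewrite zs' z3.
    have /andP[hp _] := prod_sub_bounds Hs z1.
    move: hH; rewrite HH nmM szs in hp *.
    have nz : 0 < nm z by have := s0; lra.
    have P0 : 0 < (nm z / 2) ^+ N.+1 by rewrite exprn_gt0 // divr_gt0.
    move=> hH.
    have h1 := le_trans (ler_wpM2r (nm_ge0 (g z)) hp) hH.
    have h2 : nm (g z) <= 4 * lam * 2 ^+ N.+1 / nm z.
      rewrite -(ler_pM2l P0); apply: le_trans h1 _.
      rewrite le_eqVlt; apply/orP; left; apply/eqP.
      rewrite expr_div_n (exprS (nm z)); field; rewrite ?expf_neq0 ?gt_eqF //.
    apply: le_trans h2 _; rewrite /M ler_wpM2l ?mulr_ge0 ?exprn_ge0 ?(ltW lam0) //.
    by rewrite lef_pV2 ?posrE.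
  - by [].
have hp2 : 2 * s <= nm p by rewrite nmp.
have /andP[_ hp] := prod_sub_bounds Hs hp2.
have qs := ler_wpM2r (ltW s0) q1.
have /andP[hH _] : lam * nm p ^+ N <= nm (H p) <= 4 * lam * nm p ^+ N.
  by apply: Hann; rewrite nmp; have := s0; lra.
move: hH; rewrite HH nmM szs nmp in hp * => hH.
have P0 : 0 <= (2 * (2 * s)) ^+ N.+1 by rewrite exprn_ge0 // !mulr_ge0 // ltW.
have h1 := le_trans hH (ler_pM (nm_ge0 _) (nm_ge0 _) hp bnd).
move: h1; rewrite leNgt => /negP; apply.
have -> : (2 * (2 * s)) ^+ N.+1 * M =
    (4 ^+ N.+2 / q) * (lam * (2 * s) ^+ N).
  have -> : (4 : R) ^+ N.+2 = 4 * 4 * (2 ^+ N * 2 ^+ N).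
    by rewrite -exprMn !exprS mulrA; congr (_ * _ ^+ N); lra.
  rewrite /M !(exprS _ N) exprMn; field.
  by rewrite !gt_eqF // (lt_le_trans ltr01).
have y0 : 0 < lam * (2 * s) ^+ N by rewrite mulr_gt0 // exprn_gt0 // mulr_gt0.
rewrite -[ltRHS]mul1r ltr_pM2r // /q addnS addn2 [X in _ / X]exprS.
rewrite invfM mulrCA divff ?expf_neq0 // mulr1 invf_lt1 //; lra.
Qed.

(** If the cofactor [g] of fewer than [N] zeros had no zero, its reciprocal would be
    comparable to a negative power of [|z|] and would again be much smaller far
    away than at [p]. *)
Let factors_lt zs g : factors zs g -> (size zs < N)%N ->
  exists2 z, nm z < s & g z = 0.
Proof.
move=> [Hs Hg HH] szs; apply: contrapT => nozero.
have s40 : 0 < 4 * q * s by rewrite !mulr_gt0 // (lt_le_trans ltr01).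
have qs0 : 0 < 2 * q * s by rewrite !mulr_gt0 // (lt_le_trans ltr01).
pose k := size zs; pose j := (N - k)%N.
have jk : N = (j + k)%N by rewrite subnK // ltnW.
have j0 : (0 < j)%N by rewrite subn_gt0.
have gN0 z : nm z <= 12 * q * s -> g z != 0.
  move=> hz; apply/eqP => gz.
  have [sz|zs'] := leP s (nm z); last by apply: nozero; exists z.
  have /andP[h1 _] : lam * nm z ^+ N <= nm (H z) <= 4 * lam * nm z ^+ N.
    by apply: Hann; rewrite sz hz.
  move: h1; rewrite HH gz mulr0 nm0 leNgt => /negP; apply.
  by rewrite mulr_gt0 // exprn_gt0 // (lt_le_trans s0).
pose M := 2 ^+ k / (lam * (2 * q * s) ^+ j).
have bnd : nm ((g p)^-1) <= M.
  have dV z : nm (z - p) <= 2 * (4 * q * s) -> derivable (fun w => (g w)^-1) z 1.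
    move=> /disk_p hz.
    exact: (@derivableV _ _ g z 1 (gN0 z hz) (Hg z (Edisk hz))).
  apply: (@max_modulus_off R (fun w => (g w)^-1) p (4 * q * s) M [::] s40).
  - by move=> z hz; apply: derivable_continuousC; exact: dV.
  - by move=> z hz _; exact: dV.
  - move=> z hz; have [z1 z2 z3] := around_p hz.
    have zs' : s <= nm z by have := s0; lra.
    have /andP[hH _] : lam * nm z ^+ N <= nm (H z) <= 4 * lam * nm z ^+ N.
      by apply: Hann; rewrite zs' z3.
    have /andP[_ hp] := prod_sub_bounds Hs z1.
    move: hH; rewrite HH nmM -/k in hp * => hH.
    have nz : 0 < nm z by have := s0; lra.
    have g0 : 0 < nm (g z) by rewrite nm_gt0 gN0.
    have h1 := le_trans hH (ler_wpM2r (nm_ge0 (g z)) hp).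
    have zj : 0 < nm z ^+ j by rewrite exprn_gt0.
    have h2 : lam * nm z ^+ j <= 2 ^+ k * nm (g z).
      rewrite -(ler_pM2r (exprn_gt0 k nz)); apply: le_trans (le_trans _ h1) _.
        by rewrite [X in _ <= _ * _ ^+ X]jk exprD mulrA.
      by rewrite exprMn mulrAC.
    have h3 : nm (g z)^-1 <= 2 ^+ k / (lam * nm z ^+ j).
      rewrite nmV ler_pdivlMr ?mulr_gt0 // mulrC ler_pdivrMr //.
    apply: le_trans h3 _; rewrite /M ler_wpM2l ?exprn_ge0 //.
    rewrite lef_pV2 ?posrE ?mulr_gt0 ?exprn_gt0 // ler_pM2l //.
    by rewrite lerXn2r // nnegrE ltW.
  - by [].
have hp2 : 2 * s <= nm p by rewrite nmp.
have /andP[hp _] := prod_sub_bounds Hs hp2.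
have qs := ler_wpM2r (ltW s0) q1.
have p12 : nm p <= 12 * q * s by rewrite nmp; have := s0; lra.
have /andP[_ hH] : lam * nm p ^+ N <= nm (H p) <= 4 * lam * nm p ^+ N.
  by apply: Hann; rewrite p12 andbT nmp; have := s0; lra.
have g0 : 0 < nm (g p) by rewrite nm_gt0 gN0.
move: hH; rewrite HH nmM nmp -/k in hp * => hH.
have h1 := le_trans (ler_wpM2r (nm_ge0 (g p)) hp) hH.
move: bnd; rewrite nmV /M => bnd.
have Q0 : 0 < (2 * q * s) ^+ j by rewrite exprn_gt0.
have h2 : lam * (2 * q * s) ^+ j <= 2 ^+ k * nm (g p).
  move: bnd; rewrite ler_pdivlMr ?mulr_gt0 // mulrC ler_pdivrMr //.
have h3 : (2 * s / 2) ^+ k * (lam * (2 * q * s) ^+ j) <= 2 ^+ k * (4 * lam * (2 * s) ^+ N).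
  have Y0 : 0 <= (2 * s / 2) ^+ k by rewrite exprn_ge0 // divr_ge0 // mulr_ge0 // ltW.
  apply: le_trans (ler_wpM2l Y0 h2) _.
  by rewrite mulrCA ler_wpM2l // exprn_ge0.
move: h3; rewrite leNgt => /negP; apply.
have -> : (2 * s / 2) ^+ k * (lam * (2 * q * s) ^+ j) =
    q ^+ j * (lam * (2 ^+ j * s ^+ j * s ^+ k)).
  have -> : 2 * s / 2 = s by field.
  have -> : 2 * q * s = q * (2 * s) by ring.
  rewrite !exprMn; ring.
have -> : 2 ^+ k * (4 * lam * (2 * s) ^+ N) =
    4 ^+ k.+1 * (lam * (2 ^+ j * s ^+ j * s ^+ k)).
  have -> : (4 : R) ^+ k.+1 = 4 * (2 ^+ k * 2 ^+ k).
    by rewrite -exprMn exprS; congr (_ * _ ^+ k); lra.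
  rewrite jk exprMn !exprD; ring.
have y0 : 0 < lam * (2 ^+ j * s ^+ j * s ^+ k).
  by rewrite !mulr_gt0 // exprn_gt0.
rewrite ltr_pM2r //; apply: (@lt_le_trans _ _ q).
  by rewrite /q ltr_eXn2l ?ltr1n // addn3 ltnS (leq_trans szs) // -addn2 leq_addr.
rewrite -[leLHS]expr1; apply: ler_weXn2l => //.
Qed.

(** A replacement for Rouche's theorem without an argument principle. Zeros are split
    off one by one; the growth of [H] on the annulus forbids both stopping before
    [N] zeros and going beyond [N]. In particular the multiplicities are finite. *)
Lemma zero_count : exists zs g, [/\ factors zs g, size zs = N
  & forall z, nm z <= 12 * q * s -> g z != 0].
Proof.
have grow zs g z : factors zs g -> nm z < s -> g z = 0 ->
    exists g', factors (z :: zs) g'.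
  move=> [Hs Hg HH] zs' gz.
  have Ez : E z.
    by apply: Edisk; have := ler_wpM2r (ltW s0) q1; have := s0; lra.
  have [g' dg' gE] := @holomorphic_divide R E g z Eo Ez Hg gz.
  exists g'; split=> //.
    by move=> e; rewrite inE => /orP[/eqP -> //|]; exact: Hs.
  by move=> w; rewrite HH gE big_cons; ring.
have [zs [g [F szs]]] : exists zs g, factors zs g /\ size zs = N.
  suff : forall k, (k <= N)%N -> exists zs g, factors zs g /\ size zs = k by apply.
  elim=> [_|k IH kN].
    by exists [::], H; split=> //; split=> // z; rewrite big_nil mul1r.
  have [zs [g [F szs]]] := IH (ltnW kN).
  have [|z hz gz] := factors_lt F; first by rewrite szs.
  by have [g' F'] := grow zs g z F hz gz; exists (z :: zs), g'; rewrite /= szs.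
exists zs, g; split=> // z hz; apply/eqP => gz.
have [sz|zs'] := leP s (nm z).
  have /andP[h1 _] : lam * nm z ^+ N <= nm (H z) <= 4 * lam * nm z ^+ N.
    by apply: Hann; rewrite sz hz.
  case: F => _ _ HH; move: h1; rewrite HH gz mulr0 nm0 leNgt => /negP; apply.
  by rewrite mulr_gt0 // exprn_gt0 // (lt_le_trans s0).
have [g' F'] := grow zs g z F zs' gz.
by apply: (factors_le F'); rewrite /= szs.
Qed.

End Count.
End ZeroCount.

(** * Rational functions in lowest terms *)

Section RationalFunctions.
Variable R : realType.
Local Notation C := (Cplx R).
Implicit Types (p q : {poly C}) (r : ratfun R).
Local Open Scope quotient_scope.

(** The quotient map is a fraction of images; with [reprK] this makes the pair chosen
    by [repr] a representation of [r]. *)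
Lemma pi_ratio (x : {ratio {poly C}}) :
  \pi_({fraction {poly C}}) x =
  FracField.tofrac (fraction.frac x).1 / FracField.tofrac (fraction.frac x).2.
Proof.
have d0 := denom_ratioP x.
have t0 : FracField.tofrac (fraction.frac x).2 != 0 by rewrite tofrac_eq0.
apply/(mulIf t0); rewrite mulfVK //.
rewrite !piE; apply/eqmodP; rewrite /= FracField.equivfE /FracField.mulf.
by rewrite !numden_Ratio ?oner_neq0 ?mulr1 ?mul1r // mulrC.
Qed.

Lemma ratfun_repr r :
  r = ratio_of (fraction.frac (repr r)).1 (fraction.frac (repr r)).2.
Proof. by rewrite /ratio_of -pi_ratio reprK. Qed.

Lemma div_eq_cross (F : fieldType) (x y z t : F) : y != 0 -> t != 0 ->
  (x / y = z / t) <-> (x * t = z * y).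
Proof.
by move=> y0 t0; split=> /eqP; [rewrite eqr_div // => /eqP|rewrite -eqr_div // => /eqP].
Qed.

Lemma ratio_of_eq p q p' q' : q != 0 -> q' != 0 ->
  (ratio_of p q = ratio_of p' q') <-> (p * q' = p' * q).
Proof.
move=> q0 q'0; rewrite /ratio_of.
have t0 : FracField.tofrac q != 0 by rewrite tofrac_eq0.
have t'0 : FracField.tofrac q' != 0 by rewrite tofrac_eq0.
split=> E; last by apply/(div_eq_cross _ _ t0 t'0); rewrite -!tofracM E.
move/(div_eq_cross _ _ t0 t'0)/eqP: E.
by rewrite -!tofracM tofrac_eq => /eqP.
Qed.

Lemma rden_neq0 r : rden r != 0.
Proof.
by rewrite /rden dvdp_div_eq0 ?dvdp_gcdr // denom_ratioP.
Qed.

Lemma coprime_rnum_rden r : coprimep (rnum r) (rden r).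
Proof.
by rewrite /rnum /rden; apply: coprimep_div_gcd; rewrite denom_ratioP orbT.
Qed.

Lemma ratio_of_reduced r : ratio_of (rnum r) (rden r) = r.
Proof.
rewrite [RHS]ratfun_repr; apply/ratio_of_eq; rewrite ?rden_neq0 ?denom_ratioP //.
rewrite /rnum /rden; set nd := fraction.frac _.
by rewrite mulrC !divp_mulA ?dvdp_gcdl ?dvdp_gcdr // mulrC.
Qed.

Lemma reduced_cross p q r : q != 0 -> r = ratio_of p q -> rnum r * q = p * rden r.
Proof.
move=> q0 rE; apply/(ratio_of_eq _ _ (rden_neq0 r) q0).
by rewrite ratio_of_reduced.
Qed.

Lemma rden_dvd p q r : q != 0 -> r = ratio_of p q -> rden r %| q.
Proof.
move=> q0 /(reduced_cross q0) E.
rewrite -(@Gauss_dvdpr _ _ (rnum r)) 1?coprimep_sym ?coprime_rnum_rden //.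
by rewrite E dvdp_mull.
Qed.

Lemma rnum_dvd p q r : q != 0 -> r = ratio_of p q -> rnum r %| p.
Proof.
move=> q0 /(reduced_cross q0) E.
rewrite -(@Gauss_dvdpl _ _ (rden r)) ?coprime_rnum_rden //.
by rewrite -E dvdp_mulr.
Qed.

Lemma deg_leP p (k : nat) : reflect (size p <= k.+1)%N (deg_le p k%:Z).
Proof.
apply: (iffP orP) => [[/eqP ->|]|H]; first by rewrite size_poly0.
  by rewrite -PoszD addn1 lez_nat.
by right; rewrite -PoszD addn1 lez_nat.
Qed.

(** Numerator and denominator in lowest terms divide those of any representation. *)
Lemma ratfuns_reduced (m n : nat) r : ratfuns m%:Z n%:Z r ->
  (size (rnum r) <= m.+1)%N /\ (size (rden r) <= n.+1)%N.
Proof.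
move=> [p [q [/deg_leP sp /deg_leP sq q0 rE]]]; split; last first.
  by apply: leq_trans sq; apply: dvdp_leq => //; exact: rden_dvd rE.
have [p0|p0] := eqVneq p 0.
  have := reduced_cross q0 rE; rewrite p0 mul0r => /eqP.
  by rewrite mulf_eq0 (negbTE q0) orbF => /eqP ->; rewrite size_poly0.
by apply: leq_trans sp; apply: dvdp_leq => //; exact: rnum_dvd rE.
Qed.

Lemma reval_ratio p q r z : q != 0 -> r = ratio_of p q -> q.[z] != 0 ->
  ~~ pole r z /\ reval r z = p.[z] / q.[z].
Proof.
move=> q0 rE qz.
have np : ~~ pole r z.
  apply: contra qz => /rootP dz; have /dvdpP[c ->] := rden_dvd q0 rE.
  by rewrite hornerM dz mulr0.
split=> //; rewrite /reval; apply/eqP; rewrite eqr_div //.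
by rewrite -!hornerM (reduced_cross q0 rE).
Qed.

End RationalFunctions.

(** * Linear bounds for polynomials *)

Section PolynomialBounds.
Variable R : realType.
Local Notation C := (Cplx R).
Implicit Types (p q D : {poly C}).

(** An injective linear map between spaces of rows has a left inverse, given by a
    matrix [A']; the sum of the moduli of its entries is the constant [B]. *)
Lemma linear_inj_bound (a b : nat) (phi : {linear 'rV[C]_a -> 'rV[C]_b}) :
  (forall u, phi u = 0 -> u = 0) ->
  exists2 B : R, 0 <= B &
    forall (u : 'rV[C]_a) k, nm (u 0 k) <= B * \sum_(j < b) nm (phi u 0 j).
Proof.
move=> inj.
have /row_freeP[A' AA'] : row_free (lin1_mx phi).
  by apply: inj_row_free => v; rewrite mul_rV_lin1; exact: inj.
pose B : R := \sum_(j < b) \sum_(k < a) nm (A' j k).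
have B0 : 0 <= B by apply: sumr_ge0 => j _; apply: sumr_ge0 => k _; exact: nm_ge0.
exists B => // u k.
have uE : u = phi u *m A' by rewrite -mul_rV_lin1 -mulmxA AA' mulmx1.
rewrite {1}uE mxE.
apply: le_trans (nm_sum _ _) _; rewrite mulr_sumr; apply: ler_sum => j _.
rewrite nmM mulrC; apply: ler_wpM2r; first exact: nm_ge0.
rewrite /B (bigD1 j) //= (bigD1 k) //= -addrA lerDl.
by apply: addr_ge0; apply: sumr_ge0 => i _; rewrite ?nm_ge0 // sumr_ge0 // => l _;
  exact: nm_ge0.
Qed.

Section Interpolation.
Variables (N : nat) (x : 'I_N -> C).

Let evals (u : 'rV[C]_N) : 'rV[C]_N := \row_i (rVpoly u).[x i].

Let evals_is_linear : linear evals.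
Proof.
move=> c u v; apply/rowP => i; rewrite !mxE linearP /=.
by rewrite hornerD hornerZ.
Qed.

HB.instance Definition _ :=
  GRing.isLinear.Build C 'rV[C]_N 'rV[C]_N _ evals evals_is_linear.

(** A polynomial of degree less than [N] is determined by its values at [N] distinct
    points, so that its coefficients are controlled by them. The constant does not
    depend on [eps], since a dilation only rescales the coefficients. *)
Lemma coef_le_values : injective x ->
  exists2 L : R, 0 <= L & forall D (eps T : R), (size D <= N)%N -> 0 < eps ->
    (forall i, nm D.[(eps%:C)%C * x i] <= T) ->
    forall k, nm D`_k * eps ^+ k <= L * T.
Proof.
move=> xinj.
have [|B B0 HB] := @linear_inj_bound N N evals.
  move=> u /rowP Hu.
  have ev0 i : root (rVpoly u) (x i) by have := Hu i; rewrite !mxE => /rootP.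
  have : rVpoly u = 0.
    apply: (@roots_geq_poly_eq0 _ _ [seq x i | i <- enum 'I_N]).
    - by apply/allP => _ /mapP[i _ ->].
    - by rewrite map_inj_uniq // enum_uniq.
    - by rewrite size_map size_enum_ord; exact: size_poly.
  by move=> u0; rewrite -[u]rVpolyK u0 linear0.
exists (B * N%:R); first by rewrite mulr_ge0.
move=> D eps T sD e0 HT k.
have [Nk|kN] := leqP N k.
  rewrite nth_default ?(leq_trans sD) // nm0 mul0r.
  case: (posnP N) => [->|N0]; first by rewrite mulr0 mul0r.
  by rewrite !mulr_ge0 // (le_trans (nm_ge0 _) (HT (Ordinal N0))).
pose u : 'rV[C]_N := \row_j (D`_j * (eps%:C)%C ^+ j).
have Eu i : (rVpoly u).[x i] = D.[(eps%:C)%C * x i].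
  rewrite (horner_coef_wide _ (size_poly _ _)) (horner_coef_wide _ sD).
  apply: eq_bigr => j _; rewrite coef_rVpoly_ord mxE exprMn mulrA //.
have := HB u (Ordinal kN); rewrite mxE /= nmM nmX nm_real gtr0_norm // => h.
apply: le_trans h _; rewrite -mulrA ler_wpM2l //.
apply: (@le_trans _ _ (\sum_(j < N) T)).
  by apply: ler_sum => j _; rewrite mxE Eu.
by rewrite sumr_const card_ord mulr_natl.
Qed.

End Interpolation.

Section CrossDifference.
Variables (m n : nat) (p1 q1 : {poly C}).
Hypothesis sp1 : (size p1 <= m.+1)%N.
Hypothesis sq1 : (size q1 <= n.+1)%N.
Hypothesis cop : coprimep p1 q1.
Hypothesis nondeg : size p1 = m.+1 \/ size q1 = n.+1.
Hypothesis q10 : q1`_0 != 0.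

Lemma size_cross p q : (size p <= m.+1)%N -> (size q <= n.+1)%N ->
  (size (p * q1 - p1 * q)%R <= (m + n).+1)%N.
Proof.
move=> sp sq; apply: leq_trans (size_polyD _ _) _; rewrite geq_max size_polyN.
have deg a b : (a <= m.+1)%N -> (b <= n.+1)%N -> ((a + b).-1 <= (m + n).+1)%N.
  by move=> ha hb; have := leq_add ha hb; rewrite addSn addnS; case: (a + b)%N.
by apply/andP; split; apply: leq_trans (size_polyMleq _ _) (deg _ _ _ _).
Qed.

(** The pair [(p, q)] is a polynomial multiple of [(p1, q1)] by coprimality; the
    factor is constant because one of [p1], [q1] has full degree. *)
Lemma cross_eq0 p q : (size p <= m.+1)%N -> (size q <= n.+1)%N ->
  p * q1 = p1 * q -> exists c : C, p = c *: p1 /\ q = c *: q1.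
Proof.
move=> sp sq E.
have q1n0 : q1 != 0 by apply: contra_neq q10 => ->; rewrite coef0.
have dq : q1 %| q.
  by rewrite -(@Gauss_dvdpr _ _ p1) 1?coprimep_sym // -E dvdp_mull.
have /dvdpP[c qE] := dq.
have pE : p = c * p1.
  by apply: (mulIf q1n0); rewrite E qE; ring.
have [c0|c0] := eqVneq c 0.
  by exists 0; rewrite pE qE c0 !mul0r !scale0r.
have sc : (size c <= 1)%N.
  have [s1|s1] := nondeg.
    have p1n0 : p1 != 0 by rewrite -size_poly_eq0 s1.
    move: sp; rewrite pE size_mul // s1 addnS /= => h.
    by rewrite -(leq_add2r m) add1n.
  move: sq; rewrite qE size_mul // s1 addnS /= => h.
  by rewrite -(leq_add2r n) add1n.
exists c`_0; rewrite -!mul_polyC -(size1_polyC sc) pE qE //.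
Qed.

(* The second component kills the one-dimensional kernel left by [cross_eq0]. *)
Let cross (u : 'rV[C]_(m.+1 + n.+1)) : 'rV[C]_((m + n).+1 + 1) :=
  row_mx (poly_rV (rVpoly (lsubmx u) * q1 - p1 * rVpoly (rsubmx u)))
         (\row_(_ < 1) (rVpoly (rsubmx u))`_0).

Let cross_is_linear : linear cross.
Proof.
move=> c u v; rewrite /cross scale_row_mx add_row_mx; congr row_mx.
  rewrite -linearP; congr (poly_rV _).
  by rewrite !linearP /= mulrDl mulrDr -scalerAl -scalerAr scalerBr opprD addrACA.
by apply/rowP => i; rewrite !mxE !linearP /= coefD coefZ.
Qed.

HB.instance Definition _ :=
  GRing.isLinear.Build C 'rV[C]_(m.+1 + n.+1) 'rV[C]_((m + n).+1 + 1) _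
    cross cross_is_linear.

(** Stability of [cross_eq0]: when the cross difference is small, [q] is controlled
    by its value at 0 alone. *)
Lemma den_coef_le_cross : exists2 B : R, 0 <= B &
  forall p q, (size p <= m.+1)%N -> (size q <= n.+1)%N -> forall k,
  nm q`_k <= B * (\sum_(j < (m + n).+1) nm (p * q1 - p1 * q)`_j + nm q`_0).
Proof.
have E p q : (size p <= m.+1)%N -> (size q <= n.+1)%N ->
    cross (row_mx (poly_rV p) (poly_rV q)) =
    row_mx (poly_rV (p * q1 - p1 * q)) (\row_(_ < 1) q`_0).
  by move=> sp sq; rewrite /cross row_mxKl row_mxKr !poly_rV_K.
have inj u : cross u = 0 -> u = 0.
  pose p := rVpoly (lsubmx u); pose q := rVpoly (rsubmx u).
  have uE : u = row_mx (poly_rV p) (poly_rV q) by rewrite !rVpolyK hsubmxK.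
  have sp : (size p <= m.+1)%N by exact: size_poly.
  have sq : (size q <= n.+1)%N by exact: size_poly.
  rewrite uE (E p q sp sq) -row_mx0.
  move=> /eq_row_mx[h1 /rowP/(_ 0)]; rewrite !mxE => h2.
  have h3 : p * q1 - p1 * q = 0.
    by rewrite -[LHS](@poly_rV_K _ (m + n).+1) ?size_cross // h1 linear0.
  have [c [pE qE]] := cross_eq0 sp sq (subr0_eq h3).
  have c0 : c = 0.
    by move: h2; rewrite qE coefZ => /eqP; rewrite mulf_eq0 (negbTE q10) orbF => /eqP.
  by rewrite pE qE c0 !scale0r !linear0 row_mx0.
have [B B0 HB] := linear_inj_bound inj.
exists B => // p q sp sq k.
have [nk|kn] := leqP n.+1 k.
  rewrite nth_default ?(leq_trans sq) // nm0 mulr_ge0 ?addr_ge0 ?nm_ge0 //.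
  by apply: sumr_ge0 => j _; exact: nm_ge0.
have HB' : forall (u : 'rV[C]_(m.+1 + n.+1)) i,
    nm (u 0 i) <= B * \sum_(j < (m + n).+1 + 1) nm (cross u 0 j) := HB.
have := HB' (row_mx (poly_rV p) (poly_rV q)) (rshift m.+1 (Ordinal kn)).
rewrite E // row_mxEr mxE /= => h; apply: le_trans h _; rewrite ler_wpM2l //.
rewrite big_split_ord /= big_ord1 row_mxEr mxE lerD2r.
by apply: ler_sum => j _; rewrite row_mxEl mxE.
Qed.

End CrossDifference.
End PolynomialBounds.

(** * Rational functions close to a Pade approximant *)

Section Estimate.
Variable R : realType.
Local Notation C := (Cplx R).
Implicit Types (p q D : {poly C}).

Lemma nm_horner (k : nat) q z (t : R) : (size q <= k)%N -> nm z <= t ->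
  nm q.[z] <= \sum_(j < k) nm q`_j * t ^+ j.
Proof.
move=> sq hz; rewrite (horner_coef_wide _ sq).
apply: le_trans (nm_sum _ _) _; apply: ler_sum => j _.
rewrite nmM nmX ler_wpM2l ?nm_ge0 // lerXn2r ?nnegrE ?nm_ge0 //.
exact: le_trans (nm_ge0 _) hz.
Qed.

Lemma nm_horner_le1 (k : nat) q z : (size q <= k)%N -> nm z <= 1 ->
  nm q.[z] <= \sum_(j < k) nm q`_j.
Proof.
move=> sq hz; apply: le_trans (nm_horner sq hz) _.
by apply: ler_sum => j _; rewrite expr1n mulr1.
Qed.

(** The constant coefficient drops out and the remaining powers of [z] are at most
    [nm z]. *)
Lemma nm_horner_sub0 (k : nat) q z : (size q <= k)%N -> nm z <= 1 ->
  nm (q.[z] - q`_0) <= nm z * \sum_(j < k) nm q`_j.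
Proof.
case: k => [|k] sq hz.
  move: sq; rewrite leqn0 size_poly_eq0 => /eqP ->.
  by rewrite horner0 coef0 subrr nm0 big_ord0 mulr0.
rewrite (horner_coef_wide _ sq) big_ord_recl expr0 mulr1 addrAC subrr add0r.
apply: le_trans (nm_sum _ _) _; rewrite big_ord_recl mulrDr mulr_sumr.
apply: ler_wpDl; first by rewrite mulr_ge0 ?nm_ge0.
apply: ler_sum => j _; rewrite nmM nmX lift0 exprS mulrCA.
rewrite ler_wpM2l ?nm_ge0 // -[leRHS]mulr1 ler_wpM2l ?nm_ge0 //.
by rewrite exprn_ile1 ?nm_ge0.
Qed.

Section NearPade.
Variables (m n : nat) (x : 'I_(m + n).+1 -> C) (kap L rho R1 : R).
Let N := (m + n).+1.
Hypothesis kap1 : 1 <= kap.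
Hypothesis L0 : 0 <= L.
Hypothesis HL : forall D (eps T : R), (size D <= N)%N -> 0 < eps ->
    (forall i, nm D.[(eps%:C)%C * x i] <= T) ->
    forall k, nm D`_k * eps ^+ k <= L * T.
Hypothesis hx : forall i, nm (x i) <= kap.
Hypothesis rho1 : 1 <= rho.
Hypothesis rhoL : 64 * (N%:R * L * kap ^+ N) <= rho.
Hypothesis R11 : 1 <= R1.

Variables (E : set C) (f v : C -> C) (p1 q1 : {poly C}) (d : R).
Hypothesis sp1 : (size p1 <= m.+1)%N.
Hypothesis sq1 : (size q1 <= n.+1)%N.
Hypothesis cop : coprimep p1 q1.
Hypothesis nondeg : size p1 = m.+1 \/ size q1 = n.+1.
Hypothesis q10 : q1`_0 = 1.
Hypothesis v0 : v 0 != 0.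
Hypothesis d0 : 0 < d.
Hypothesis d1 : d <= 1.
Hypothesis loc : forall z, nm z < d ->
  [/\ E z, nm (q1.[z] - 1) <= 1 / 16 & nm (v z - v 0) <= nm (v 0) / 16].
Hypothesis pade_eq : forall z, E z -> p1.[z] - q1.[z] * f z = v z * z ^+ N.

Let b := nm (v 0).
Let b0 : 0 < b. Proof. by rewrite nm_gt0. Qed.
Let W := R1 * rho * kap.
Let kap0 : 0 < kap. Proof. exact: lt_le_trans kap1. Qed.
Let rho0 : 0 < rho. Proof. exact: lt_le_trans rho1. Qed.
Let R10 : 0 < R1. Proof. exact: lt_le_trans R11. Qed.
Let W0 : 0 < W. Proof. by rewrite !mulr_gt0. Qed.
Let kN0 : 0 <= kap ^+ N. Proof. by rewrite exprn_ge0 // ltW. Qed.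

Let loc_bounds z : nm z < d ->
  [/\ 15 / 16 <= nm q1.[z] <= 17 / 16 & nm (v z) <= 17 / 16 * b].
Proof.
move=> /loc[_ h1 h2].
have := nmD (q1.[z] - 1) 1; rewrite subrK nm1.
have := nmD (1 - q1.[z]) q1.[z]; rewrite subrK nm1 (nmB 1).
have := nmD (v z - v 0) (v 0); rewrite subrK -/b.
rewrite -/b in h2 * => g1 g2 g3.
by split; [apply/andP; split|]; lra.
Qed.

Lemma pade_error z (eps : R) : 0 < eps -> eps * kap < d -> nm z <= eps * kap ->
  q1.[z] != 0 /\ nm (p1.[z] / q1.[z] - f z) <= 2 * b * (kap ^+ N * eps ^+ N).
Proof.
move=> e0 ek hz; have zd : nm z < d := le_lt_trans hz ek.
have [/andP[h1 h2] h3] := loc_bounds zd; have [Ez _ _] := loc zd.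
have q1z : q1.[z] != 0 by rewrite -nm_gt0; lra.
split=> //.
have -> : p1.[z] / q1.[z] - f z = v z * z ^+ N / q1.[z].
  by rewrite -pade_eq //; field.
rewrite !nmM nmV nmX ler_pdivrMr; last by rewrite nm_gt0.
have zN : nm z ^+ N <= kap ^+ N * eps ^+ N.
  by rewrite -exprMn lerXn2r ?nnegrE ?nm_ge0 ?mulr_ge0 ?(ltW e0) ?(ltW kap0) // mulrC.
set Z := kap ^+ N * eps ^+ N in zN *.
have Z0 : 0 <= Z := le_trans (exprn_ge0 _ (nm_ge0 _)) zN.
have bZ : 0 <= b * Z by rewrite mulr_ge0 // ltW.
have g1 : nm (v z) * nm z ^+ N <= 17 / 16 * b * Z.
  by apply: ler_pM; rewrite ?nm_ge0 ?exprn_ge0 ?nm_ge0.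
have := ler_wpM2l bZ h1; lra.
Qed.

(** If the error of [p / q] at the dilated points is of the order of the Pade error,
    then the cross difference [D] of [p / q] and [p1 / q1], of degree less than [N],
    is of order [eps ^ N] at these points. Its coefficient of index [j] is thus of
    order [eps ^ (N - j)], so that all of them are small, and by [den_coef_le_cross]
    the denominator [q] is nearly constant at scale [eps]. Now
    [q1 * (p - q * f) = D + q * v * z ^ N]: the last term is close to
    [q`_0 * v 0 * z ^ N], and outside the disk of radius [eps * rho] the modulus of [D] is
    at most an eighth of that of [q`_0 * v 0 * z ^ N], which is the role of the factor
    64 in [rhoL]. *)
Lemma near_pade_annulus : exists2 e0 : R, 0 < e0 &
  forall eps : R, 0 < eps -> eps < e0 -> forall p q,
  (size p <= m.+1)%N -> (size q <= n.+1)%N -> q != 0 ->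
  (forall i, q.[(eps%:C)%C * x i] != 0) ->
  (forall i, nm (p.[(eps%:C)%C * x i] / q.[(eps%:C)%C * x i] - f ((eps%:C)%C * x i))
      <= 2 * b * (kap ^+ N * eps ^+ N)) ->
  [/\ 0 < b * nm q`_0 / 2,
      forall z, nm z <= R1 * (eps * rho) -> q.[z] != 0
    & forall z, eps * rho <= nm z <= R1 * (eps * rho) ->
      b * nm q`_0 / 2 * nm z ^+ N <= nm (p.[z] - q.[z] * f z)
        <= 4 * (b * nm q`_0 / 2) * nm z ^+ N].
Proof.
have q1n0 : q1`_0 != 0 by rewrite q10 oner_neq0.
have [B B0 HB] := den_coef_le_cross sp1 sq1 cop nondeg q1n0.
pose X := 5 * L * b * kap ^+ N.
have X0 : 0 <= X by rewrite !mulr_ge0 // ltW.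
pose c1 := n.+1%:R * B * (N%:R * X).
have c10 : 0 <= c1 := mulr_ge0 (mulr_ge0 (ler0n _ _) B0) (mulr_ge0 (ler0n _ _) X0).
pose G := 2 * (n.+1%:R * B).
have G0 : 0 <= G := mulr_ge0 (ler0n _ _) (mulr_ge0 (ler0n _ _) B0).
pose e0 := Num.min 1 (Num.min (1 / (2 * (c1 + 1)))
             (Num.min (d / W) (1 / (16 * (G + 1) * W)))).
exists e0.
  by rewrite !lt_min ltr01 !divr_gt0 ?mulr_gt0 //; lra.
move=> eps eps0; rewrite !lt_min => /and4P[ee1 ee2 ee3 ee4] p q sp sq qn0 qx err.
have ec1 : eps * c1 <= 1 / 2.
  move: ee2; rewrite ltr_pdivlMr; lra.
have eW : eps * W < d by rewrite -ltr_pdivlMr.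
have eWG : eps * W * G <= 1 / 16.
  move: ee4; rewrite ltr_pdivlMr ?mulr_gt0 //; last by lra.
  have : 0 <= eps * W by rewrite mulr_ge0 // ltW.
  lra.
have kW : kap <= W.
  by rewrite /W ler_peMl // ?(ltW kap0) // mulr_ege1.
have rW : R1 * rho <= W by rewrite /W ler_peMr // mulr_ge0 // ltW.
have ekd : eps * kap < d by apply: le_lt_trans eW; rewrite ler_pM2l.
have nx i : nm ((eps%:C)%C * x i) <= eps * kap.
  by rewrite nmM nm_real gtr0_norm // ler_pM2l.
have xd i : nm ((eps%:C)%C * x i) < d := le_lt_trans (nx i) ekd.
pose D := p * q1 - p1 * q.
have sD : (size D <= N)%N by exact: size_cross.
(* the coefficients of [D] in terms of a bound [Q] for [q] at the dilated points;
   it is used with a crude [Q] to control [q], then with [Q] close to [nm q`_0] *)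
have HD Q : 0 <= Q -> (forall i, nm q.[(eps%:C)%C * x i] <= Q) ->
    forall j, nm D`_j * eps ^+ j <= X * eps ^+ N * Q.
  move=> Q0 HQ j.
  have -> : X * eps ^+ N * Q = L * (5 * b * (kap ^+ N * eps ^+ N) * Q).
    by rewrite /X; ring.
  apply: HL => // i; move: (nx i) (xd i) (qx i) (err i) (HQ i).
  move: ((eps%:C)%C * x i) => z zk zd qz errz Qz.
  have [/andP[_ h2] h3] := loc_bounds zd; have [Ez _ _] := loc zd.
  have -> : D.[z] = q.[z] * (q1.[z] * (p.[z] / q.[z] - f z) - v z * z ^+ N).
    by rewrite -pade_eq // /D hornerD hornerN !hornerM; field.
  have zN : nm z ^+ N <= kap ^+ N * eps ^+ N.
    by rewrite -exprMn lerXn2r ?nnegrE ?nm_ge0 ?mulr_ge0 ?(ltW eps0) ?(ltW kap0) // mulrC.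
  set Z := kap ^+ N * eps ^+ N in zN errz *.
  have Z0 : 0 <= Z := le_trans (exprn_ge0 _ (nm_ge0 _)) zN.
  have bZ : 0 <= b * Z by rewrite mulr_ge0 // ltW.
  have g1 : nm (v z) * nm z ^+ N <= 17 / 16 * b * Z.
    by apply: ler_pM; rewrite ?nm_ge0 ?exprn_ge0 ?nm_ge0.
  have g2 : nm q1.[z] * nm (p.[z] / q.[z] - f z) <= 17 / 16 * (2 * b * Z).
    by apply: ler_pM; rewrite ?nm_ge0.
  rewrite nmM mulrC; apply: ler_pM; rewrite ?nm_ge0 //.
  apply: le_trans (nmDB _ _) _.
  rewrite (nmM q1.[z]) (nmM (v z)) nmX; lra.
pose Sq := \sum_(j < n.+1) nm q`_j.
have Sq0 : 0 <= Sq by apply: sumr_ge0 => j _; exact: nm_ge0.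
(* the sum [Sq] occurs on both sides; [ec1] makes its contribution on the right at
   most one half of it *)
have SqE : Sq <= G * nm q`_0.
  have HQ i : nm q.[(eps%:C)%C * x i] <= Sq.
    by apply: nm_horner_le1 => //; apply: le_trans d1; exact: ltW.
  have Dj (j : 'I_N) : nm D`_j <= X * Sq * eps.
    have := HD Sq Sq0 HQ j.
    have -> : X * eps ^+ N * Sq = X * Sq * eps * (eps ^+ (N - j.+1) * eps ^+ j).
      rewrite -exprD; have -> : (N - j.+1 + j = m + n)%N.
        by rewrite subSS subnK // -ltnS.
      by rewrite /N exprS; ring.
    move=> h; rewrite -(ler_pM2r (exprn_gt0 j eps0)); apply: le_trans h _.
    apply: (ler_wpM2l (mulr_ge0 (mulr_ge0 X0 Sq0) (ltW eps0))).
    rewrite -[leRHS]mul1r; apply: ler_wpM2r; first by rewrite exprn_ge0 // ltW.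
    by rewrite exprn_ile1 // ltW.
  have SD : \sum_(j < N) nm D`_j <= N%:R * (X * Sq * eps).
    apply: (@le_trans _ _ (\sum_(j < N) (X * Sq * eps))).
      by apply: ler_sum => j _; exact: Dj.
    by rewrite sumr_const card_ord [leRHS]mulr_natl.
  have : Sq <= n.+1%:R * (B * (N%:R * (X * Sq * eps) + nm q`_0)).
    apply: (@le_trans _ _ (\sum_(j < n.+1) (B * (N%:R * (X * Sq * eps) + nm q`_0)))).
      apply: ler_sum => j _; apply: le_trans (HB p q sp sq j) _.
      by rewrite ler_wpM2l // lerD2r.
    by rewrite sumr_const card_ord [leRHS]mulr_natl.
  have := ler_wpM2l Sq0 ec1; rewrite /c1 /G.
  set T1 := n.+1%:R * B * nm q`_0.
  have -> : n.+1%:R * (B * (N%:R * (X * Sq * eps) + nm q`_0)) =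
     Sq * (eps * (n.+1%:R * B * (N%:R * X))) + T1 by rewrite /T1; ring.
  have -> : 2 * (n.+1%:R * B) * nm q`_0 = 2 * T1 by rewrite /T1; ring.
  lra.
have q00 : 0 < nm q`_0.
  rewrite lt_def nm_ge0 andbT; apply: contra_neq qn0 => qz.
  have Sz : Sq = 0 by apply/eqP; rewrite eq_le Sq0 andbT; move: SqE; rewrite qz mulr0.
  apply/polyP => k; rewrite coef0; have [kn|kn] := ltnP k n.+1; last first.
    by rewrite nth_default // (leq_trans sq).
  have := @psumr_eq0P _ _ _ (fun j : 'I_n.+1 => nm q`_j) (fun j _ => nm_ge0 _) Sz.
  by move=> /(_ (Ordinal kn) isT) /eqP; rewrite nm_eq0 => /eqP.
have qnear z : nm z <= eps * W -> nm (q.[z] - q`_0) <= nm q`_0 / 16.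
  move=> hz; have z1 : nm z <= 1 by have := d1; lra.
  apply: le_trans (nm_horner_sub0 sq z1) _.
  have h1 : nm z * Sq <= eps * W * (G * nm q`_0) by apply: ler_pM; rewrite ?nm_ge0.
  apply: le_trans h1 _; rewrite mulrA.
  by apply: le_trans (ler_wpM2r (nm_ge0 q`_0) eWG) _; lra.
have inW z : nm z <= R1 * (eps * rho) -> nm z <= eps * W.
  move=> hz; apply: le_trans hz _.
  have -> : R1 * (eps * rho) = eps * (R1 * rho) by ring.
  by rewrite ler_pM2l.
split.
- by rewrite divr_gt0 // mulr_gt0.
- move=> z /inW /qnear h; rewrite -nm_gt0.
  by have := nmD (q`_0 - q.[z]) q.[z]; rewrite subrK (nmB q`_0); lra.
move=> z /andP[z1 z2]; have zW := inW z z2.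
have zd : nm z < d := le_lt_trans zW eW.
have [/andP[h1 h2] h3] := loc_bounds zd; have [Ez _ h4] := loc zd.
have hq := qnear z zW.
have HQ i : nm q.[(eps%:C)%C * x i] <= 17 / 16 * nm q`_0.
  have h : nm (q.[(eps%:C)%C * x i] - q`_0) <= nm q`_0 / 16.
    by apply: qnear; apply: le_trans (nx i) _; rewrite ler_pM2l.
  by have := nmD (q.[(eps%:C)%C * x i] - q`_0) q`_0; rewrite subrK; lra.
have Q0 : 0 <= 17 / 16 * nm q`_0 by rewrite mulr_ge0 ?nm_ge0 // divr_ge0.
set t := nm z in z1 z2 zW zd *.
have t0 : 0 < t by apply: lt_le_trans z1; rewrite mulr_gt0.
have te : eps <= t by apply: le_trans z1; rewrite ler_peMr // ltW.
pose A := b * nm q`_0 * t ^+ N.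
have A0 : 0 <= A by rewrite !mulr_ge0 ?exprn_ge0 ?nm_ge0 ?(ltW b0) ?(ltW t0).
have Dz : nm D.[z] <= A / 8.
  pose Y := X * (17 / 16 * nm q`_0).
  have Y0 : 0 <= Y by rewrite mulr_ge0.
  have Dj (j : 'I_N) : nm D`_j * t ^+ j <= Y * (eps * t ^+ (m + n)).
    have h := HD _ Q0 HQ j.
    have E1 : t ^+ j = eps ^+ j * (t / eps) ^+ j.
      by rewrite -exprMn mulrC mulfVK // gt_eqF.
    have E2 : Y * (eps * t ^+ (m + n)) =
        X * eps ^+ N * (17 / 16 * nm q`_0) * (t / eps) ^+ (m + n).
      have -> : t ^+ (m + n) = eps ^+ (m + n) * (t / eps) ^+ (m + n).
        by rewrite -exprMn mulrC mulfVK // gt_eqF.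
      by rewrite /Y /N exprS; ring.
    have te0 : 1 <= t / eps by rewrite ler_pdivlMr // mul1r.
    rewrite E1 E2 mulrA; apply: ler_pM => //.
    - by rewrite mulr_ge0 ?nm_ge0 // exprn_ge0 // ltW.
    - by rewrite exprn_ge0 // (le_trans ler01).
    - by rewrite ler_weXn2l // -ltnS.
  have h5 : nm D.[z] <= N%:R * (Y * (eps * t ^+ (m + n))).
    apply: le_trans (nm_horner sD (lexx t)) _.
    apply: (@le_trans _ _ (\sum_(j < N) (Y * (eps * t ^+ (m + n))))).
      by apply: ler_sum => j _; exact: Dj.
    by rewrite sumr_const card_ord [leRHS]mulr_natl.
  apply: le_trans h5 _.
  have h6 : eps * t ^+ (m + n) <= t ^+ N / rho.
    rewrite ler_pdivlMr // mulrAC /N exprS ler_wpM2r // exprn_ge0 // ltW //.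
  have NY : 0 <= N%:R * Y by rewrite mulr_ge0.
  rewrite mulrA; apply: le_trans (ler_wpM2l NY h6) _.
  rewrite mulrA ler_pdivrMr //.
  have -> : N%:R * Y * t ^+ N = 85 / 16 * (N%:R * L * kap ^+ N) * A.
    by rewrite /Y /X /A; field.
  have h7 : 85 / 16 * (N%:R * L * kap ^+ N) <= rho / 8.
    have : 0 <= N%:R * L * kap ^+ N by rewrite !mulr_ge0.
    have := rhoL; lra.
  have := ler_wpM2r A0 h7; lra.
have H1 : q1.[z] * (p.[z] - q.[z] * f z) = D.[z] + q.[z] * v z * z ^+ N.
  rewrite -mulrA -pade_eq // /D hornerD hornerN !hornerM; ring.
have qv : nm (q.[z] * v z - q`_0 * v 0) <= 33 / 256 * (b * nm q`_0).
  have -> : q.[z] * v z - q`_0 * v 0 = (q.[z] - q`_0) * v z + q`_0 * (v z - v 0) by ring.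
  apply: le_trans (nmD _ _) _; rewrite !nmM.
  have g1 : nm (q.[z] - q`_0) * nm (v z) <= nm q`_0 / 16 * (17 / 16 * b).
    by apply: ler_pM; rewrite ?nm_ge0.
  have g2 : nm q`_0 * nm (v z - v 0) <= nm q`_0 * (b / 16).
    by rewrite ler_wpM2l ?nm_ge0.
  lra.
have tN0 : 0 <= t ^+ N by rewrite exprn_ge0 // ltW.
have qvz : nm (q.[z] * v z * z ^+ N - q`_0 * v 0 * z ^+ N) <= 33 / 256 * A.
  rewrite -mulrBl nmM nmX -/t /A.
  by have := ler_wpM2r tN0 qv; lra.
have nq0v : nm (q`_0 * v 0 * z ^+ N) = A.
  by rewrite !nmM nmX -/t -/b /A (mulrC (nm q`_0)).
have up : nm q1.[z] * nm (p.[z] - q.[z] * f z) <= 322 / 256 * A.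
  rewrite -nmM H1; apply: le_trans (nmD _ _) _.
  have := nmD (q.[z] * v z * z ^+ N - q`_0 * v 0 * z ^+ N) (q`_0 * v 0 * z ^+ N).
  rewrite subrK nq0v; lra.
have lo : 190 / 256 * A <= nm q1.[z] * nm (p.[z] - q.[z] * f z).
  rewrite -nmM H1.
  have := nmDB (D.[z] + q.[z] * v z * z ^+ N) D.[z]; rewrite addrAC subrr add0r.
  have := nmD (q`_0 * v 0 * z ^+ N - q.[z] * v z * z ^+ N) (q.[z] * v z * z ^+ N).
  rewrite subrK nq0v nmB; lra.
have Hn0 := nm_ge0 (p.[z] - q.[z] * f z).
have := ler_wpM2r Hn0 h1; have := ler_wpM2r Hn0 h2.
have -> : b * nm q`_0 / 2 * t ^+ N = A / 2 by rewrite /A; field.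
have -> : 4 * (b * nm q`_0 / 2) * t ^+ N = 2 * A by rewrite /A; field.
by move=> g1 g2; apply/andP; split; lra.
Qed.

End NearPade.
End Estimate.

(** * Perfect sets, uniform distance and Pade approximants *)

Section Setting.
Variable R : realType.
Local Notation C := (Cplx R).
Implicit Types (p q : {poly C}) (E K : set C) (f : C -> C).

Lemma compact_nm_bounded K : compact K ->
  exists2 kap : R, 1 <= kap & forall z, K z -> nm z <= kap.
Proof.
move=> Kc.
have nmc : continuous (@nm R : C -> R).
  move=> z; have W := (@cvgrPdist_lt R R^o C (nbhs z) _ (@nm R) (nm z)).2.
  apply: W => e e0; apply: (nbhsCP _ _).2; exists e => // w hw.
  apply: le_lt_trans hw; rewrite ler_norml.
  have := nmD (w - z) z; have := nmD (z - w) w; rewrite !subrK (nmB z w).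
  by move=> h1 h2; apply/andP; split; lra.
have : compact (@nm R @` K).
  by apply: continuous_compact => //; exact: continuous_subspaceT.
move=> /compact_bounded [M [_ HM]].
exists (Num.max 1 (M + 1)); first by rewrite le_max lexx.
move=> z Kz; rewrite le_max; apply/orP; right.
have := HM (M + 1); rewrite ltrDl ltr01 => /(_ isT) /(_ (nm z)).
by rewrite /= ger0_norm ?nm_ge0 //; apply; exists z.
Qed.

(** A point of [s] in [K] is approached by points of [K] that are closer to it than
    all the other points of [s]. *)
Lemma perfect_avoid K (s : seq C) : K !=set0 -> isolated K = set0 ->
  exists2 z, K z & z \notin s.
Proof.
move=> [z0 Kz0] iso.
have [z0s|] := boolP (z0 \in s); last by exists z0.
have [d d0 [_ Hd]] := separation_radius z0 s ltr01.
apply: contrapT => none.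
have : isolated K z0.
  split; first by rewrite inE.
  exists [set w | nm (w - z0) < d].
    by apply: (nbhsCP _ _).2; exists d.
  apply/seteqP; split=> w /=; last by move=> ->; rewrite subrr nm0.
  move=> [hw Kw]; apply: contrapT => /eqP wz; apply: none; exists w => //.
  by apply/negP => ws; have := Hd w ws wz; rewrite leNgt hw.
by rewrite iso.
Qed.

Lemma perfect_points K (N : nat) : K !=set0 -> isolated K = set0 ->
  exists2 x : 'I_N -> C, injective x & forall i, K (x i).
Proof.
move=> K0 iso.
have [s [us ss Ks]] : exists s : seq C,
    [/\ uniq s, size s = N & forall z, z \in s -> K z].
  elim: N => [|N [s [us ss Ks]]]; first by exists [::].
  have [z Kz zs] := perfect_avoid s K0 iso; exists (z :: s); split=> /=.
  - by rewrite zs.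
  - by rewrite ss.
  - by move=> w; rewrite inE => /orP[/eqP ->|/Ks].
exists (fun i => nth 0 s i) => [i j /eqP|i].
  by rewrite nth_uniq ?ss // => /eqP /val_inj.
by apply: Ks; rewrite mem_nth ?ss.
Qed.

Lemma derivable_hornerC p (z : C) : derivable (fun w => p.[w]) z 1.
Proof.
elim/poly_ind: p => [|p c IH].
  under eq_fun do rewrite horner0; exact: derivable_cst.
under eq_fun do rewrite hornerMXaddC.
exact: derivableD (derivableM IH (@derivable_id _ _ z 1)) (@derivable_cst _ _ _ c z 1).
Qed.

Lemma dil_nm (eps : R) K z (kap : R) : 0 < eps -> (forall w, K w -> nm w <= kap) ->
  dil eps K z -> nm z <= eps * kap.
Proof.
move=> e0 HK [w Kw <-]; rewrite nmM nm_real gtr0_norm // ler_pM2l //; exact: HK.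
Qed.

Lemma disk_nm z : @disk R z <-> nm z <= 1.
Proof.
have E : (`|z| <= 1) = (nm z <= 1) := lecR (nm z) 1.
by rewrite /disk /= E.
Qed.

Lemma dil_diskP (eps rho : R) z : 0 < eps -> 0 < rho ->
  dil eps (dil rho (@disk R)) z <-> nm z <= eps * rho.
Proof.
move=> e0 r0; split.
  apply: dil_nm => // w /(dil_nm r0) H; rewrite -[rho]mulr1; apply: H.
  by move=> t /disk_nm.
move=> hz; have er0 : 0 < eps * rho by rewrite mulr_gt0.
have eN : (eps%:C)%C != 0 :> C by rewrite -nm_gt0 nm_real gtr0_norm.
have rN : (rho%:C)%C != 0 :> C by rewrite -nm_gt0 nm_real gtr0_norm.
exists ((rho%:C)%C * (z / ((eps%:C)%C * (rho%:C)%C))).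
  exists (z / ((eps%:C)%C * (rho%:C)%C)) => //; apply/disk_nm.
  rewrite nmM nmV nmM !nm_real !gtr0_norm // ler_pdivrMr //; lra.
by field; rewrite eN rN.
Qed.

Lemma sup_dist_le (S : set C) (r : ratfun R) f (M : R) :
  (forall z, S z -> ~~ pole r z /\ nm (reval r z - f z) <= M) ->
  (sup_dist S r f <= M%:E)%E.
Proof.
move=> H; rewrite /sup_dist; case: asboolP => [[z Sz pz]|_].
  by have [/negP] := H z Sz.
by apply: ge_ereal_sup => _ [z Sz <-]; rewrite lee_fin; have [] := H z Sz.
Qed.

Lemma le_sup_dist (S : set C) (r : ratfun R) f (M : R) z :
  (sup_dist S r f <= M%:E)%E -> S z ->
  ~~ pole r z /\ nm (reval r z - f z) <= M.
Proof.
rewrite /sup_dist; case: asboolP => [_|np H Sz].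
  by rewrite leye_eq.
split; first by apply/negP => pz; apply: np; exists z.
rewrite -lee_fin; apply: le_trans H; apply: ereal_sup_ubound.
by exists z.
Qed.

(** A non-degenerate Pade approximant in lowest terms still satisfies the
    linearized interpolation condition, because the cancelled factor can only be
    a constant; in particular it has no pole at 0, where a common zero of [p1] and
    [q1] would contradict coprimality. *)
Lemma pade_normal_form (m n : nat) E f (rP : ratfun R) : E 0 ->
  pade m n E f rP -> nondegenerate_in m n rP ->
  exists p1 q1 v, [/\ [/\ (size p1 <= m.+1)%N, (size q1 <= n.+1)%N, coprimep p1 q1
        & size p1 = m.+1 \/ size q1 = n.+1],
      q1`_0 = 1, rP = ratio_of p1 q1, holomorphic_on E v
    & forall z, E z -> p1.[z] - q1.[z] * f z = v z * z ^+ (m + n).+1].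
Proof.
move=> E0 [_ [p [q [/deg_leP sp /deg_leP sq q0 rE [v hv pade_eq]]]]] [_ nondeg].
have {}pade_eq z : E z -> p.[z] - q.[z] * f z = v z * z ^+ (m + n).+1.
  move=> Ez; rewrite pade_eq //; congr (_ * _).
  rewrite -[tval _]/(nseq (m + n).+1 (0 : C)).
  by rewrite big_nseq subr0 iter_mulr_1.
pose a := rnum rP; pose b := rden rP.
have b0 : b != 0 := rden_neq0 rP.
have ab : coprimep a b := coprime_rnum_rden rP.
have [c qE] := dvdpP _ _ (rden_dvd q0 rE).
have pE : p = c * a.
  have E1 : a * q = p * b := reduced_cross q0 rE.
  by apply: (mulIf b0); rewrite -E1 qE -/b; ring.
have c0 : c != 0 by apply: contra_neq q0 => ch; rewrite qE ch mul0r.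
have sb : (size b <= n.+1)%N.
  by apply: leq_trans sq; apply: dvdp_leq => //; apply/dvdpP; exists c.
have sa : (size a <= m.+1)%N.
  have [->|a0] := eqVneq a 0; first by rewrite size_poly0.
  apply: leq_trans sp; apply: dvdp_leq; first by rewrite pE mulf_neq0.
  by apply/dvdpP; exists c.
have full : size a = m.+1 \/ size b = n.+1.
  have [ha|ha] := eqVneq (size a) m.+1; first by left.
  have [hb|hb] := eqVneq (size b) n.+1; first by right.
  exfalso; suff : (1 <= 0)%N by [].
  apply: nondeg; exists a, b; split=> //.
  - by apply/orP; right; rewrite subrK lez_nat -ltnS ltn_neqAle ha.
  - by apply/orP; right; rewrite subrK lez_nat -ltnS ltn_neqAle hb.
  - by rewrite ratio_of_reduced.
have sc : (size c <= 1)%N.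
  case: full => s1.
    have a0 : a != 0 by rewrite -size_poly_eq0 s1.
    move: sp; rewrite pE size_mul // s1 addnS /= => h.
    by rewrite -(leq_add2r m) add1n.
  move: sq; rewrite qE size_mul // -/b s1 addnS /= => h.
  by rewrite -(leq_add2r n) add1n.
pose k := c`_0; have cE : c = k%:P by exact: size1_polyC.
have k0 : k != 0 by apply: contra_neq c0 => h; rewrite cE h polyC0.
have red_eq z : E z -> a.[z] - b.[z] * f z = k^-1 * v z * z ^+ (m + n).+1.
  move=> Ez; apply: (mulfI k0); rewrite !mulrA divff // mul1r -pade_eq //.
  by rewrite pE qE -/b cE !hornerM !hornerC; ring.
have b00 : b.[0] != 0.
  have := red_eq 0 E0; rewrite expr0n mulr0 => /eqP; rewrite subr_eq0 => /eqP ha.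
  have [hb|//] := eqVneq b.[0] 0.
  have : root a 0 by apply/rootP; rewrite ha hb mul0r.
  by move/(coprimep_root ab); rewrite hb eqxx.
pose l := b.[0]^-1; have l0 : l != 0 by rewrite invr_eq0.
exists (l *: a), (l *: b), (fun z => (l * k^-1) * v z); split.
- rewrite !size_scale // coprimepZl // coprimepZr //.
- by rewrite coefZ -horner_coef0 mulVf.
- rewrite -[LHS]ratio_of_reduced; apply/ratio_of_eq => //.
    by rewrite scaler_eq0 negb_or l0.
  by rewrite -scalerAl -scalerAr.
- move=> z Ez; exact: (@derivableZ _ _ _ v (l * k^-1) z 1 (hv z Ez)).
- by move=> z Ez; rewrite !hornerZ -!mulrA -mulrBr red_eq // -!mulrA.
Qed.

(** If [v] vanished at 0, the Pade error would be of smaller order than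
    [z ^ (m + n).+1], hence [a] would be 0. *)
Lemma pade_coef_neq0 (m n : nat) E f (rP : ratfun R) (a : C) p1 q1 (v : C -> C) :
  open E -> E 0 -> q1`_0 = 1 -> rP = ratio_of p1 q1 -> holomorphic_on E v ->
  (forall z, E z -> p1.[z] - q1.[z] * f z = v z * z ^+ (m + n).+1) ->
  pade_coef m n f rP a -> a != 0 -> v 0 != 0.
Proof.
move=> Eo E0 q10 rE hv pade_eq /eqO_exP [k k0 /(nbhsCP _ _).1 [d d0 Hk]] a0.
apply/eqP => v0.
have q1n0 : q1 != 0.
  by apply/eqP => h; move: q10; rewrite h coef0 => /eqP; rewrite eq_sym oner_eq0.
have kE : k = ((complex.Re (k : R[i]))%:C)%C :> C.
  by rewrite [RHS]RRe_real //; exact: gtr0_real.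
set k' := complex.Re _ in kE.
have k'0 : 0 < k' by rewrite -ltcR; move: k0; rewrite {1}kE.
have na : 0 < nm a by rewrite nm_gt0.
have na4 : 0 < nm a / 4 by rewrite divr_gt0.
have [d1 d10 H1] := (nbhsCP _ _).1 (open_nbhs_nbhs (conj Eo E0)).
have [d2 d20 H2] := (continuousCP _ _).1 (derivable_continuousC (hv 0 E0)) _ na4.
have half0 : (0 : R) < 1 / 2 by rewrite divr_gt0.
have [d3 d30 H3] := (continuousCP _ _).1
  (derivable_continuousC (@derivable_hornerC q1 0)) _ half0.
pose t := Num.min (Num.min d d1) (Num.min (Num.min d2 d3) (nm a / (4 * k'))) / 2.
have t0 : 0 < t.
  by rewrite divr_gt0 // !lt_min d0 d10 d20 d30 divr_gt0 // mulr_gt0.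
have : 2 * t <= Num.min (Num.min d d1) (Num.min (Num.min d2 d3) (nm a / (4 * k'))).
  by rewrite /t; lra.
rewrite !le_min => /and3P[/andP[t1 t2] /andP[t3 t4]].
rewrite ler_pdivlMr ?mulr_gt0 // => t5.
pose z : C := (t%:C)%C.
have nz : nm z = t by rewrite nm_real gtr0_norm.
have z0 : z != 0 by rewrite -nm_gt0 nz.
have zz : nm (z - 0) = t by rewrite subr0.
have Ez : E z by apply: H1; rewrite zz; lra.
have vz : nm (v z) < nm a / 4.
  by have := H2 z; rewrite zz v0 subr0; apply; lra.
have qz : 1 / 2 <= nm q1.[z].
  have : nm (q1.[z] - q1.[0]) < 1 / 2 by apply: H3; rewrite zz; lra.
  rewrite (horner_coef0 q1) q10.
  have := nmD (1 - q1.[z]) q1.[z]; rewrite subrK nm1 (nmB 1); lra.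
have qz0 : q1.[z] != 0 by rewrite -nm_gt0; lra.
have [_ rz] := reval_ratio q1n0 rE qz0.
have hz : nm (z - 0) < d by rewrite zz; lra.
have := Hk z hz; rewrite kE !normE -rmorphM /= [_ <= _]lecR.
have -> : reval rP z - f z - a * z ^+ (m + n).+1 = (v z / q1.[z] - a) * z ^+ (m + n).+1.
  rewrite rz mulrBl [v z / _ * _]mulrAC -pade_eq //; field; exact: qz0.
have zN : 0 < t ^+ (m + n).+1 by rewrite exprn_gt0.
rewrite nmM !nmX nz [t ^+ (m + n).+2]exprS mulrA ler_pM2r // => h.
have h2 : nm (v z / q1.[z]) <= nm a / 2.
  rewrite nmM nmV ler_pdivrMr ?nm_gt0 //.
  have na0 : 0 <= nm a / 2 by lra.
  have := ler_wpM2l na0 qz; lra.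
have := nmD (a - v z / q1.[z]) (v z / q1.[z]); rewrite subrK (nmB a); lra.
Qed.

Lemma prod_sub_split (zs : seq C) (z w : C) :
  \prod_(e <- zs) (w - e) =
  (w - z) ^+ count_mem z zs * \prod_(e <- [seq e <- zs | e != z]) (w - e).
Proof.
elim: zs => [|e zs IH]; first by rewrite !big_nil expr0 mulr1.
rewrite big_cons IH /=; case: eqVneq => [->|_] /=.
  by rewrite add1n exprS mulrA.
by rewrite add0n big_cons mulrCA.
Qed.

End Setting.

(** * Zeros of the Chebyshev error *)

Section Counting.
Variable R : realType.
Local Notation C := (Cplx R).
Implicit Types (p q : {poly C}) (E K : set C) (f : C -> C).

(** The denominator being zero-free on the disk of radius [T], the error and the
    linearized error have the same zeros there, with the same multiplicities. The
    radius is larger than that of [S] because multiplicities are a matter of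
    neighbourhoods. *)
Lemma nb_zeros_of_factors (S : set C) (r : ratfun R) f (zs : seq C) (g : C -> C)
    (T : R) :
  (forall z, S z -> nm z < T) -> (forall z, z \in zs -> S z) ->
  (forall z, nm z < T -> (rden r).[z] != 0) ->
  (forall z, nm z < T -> derivable g z 1) ->
  (forall z, nm z < T -> g z != 0) ->
  (forall z, (rnum r).[z] - (rden r).[z] * f z = \prod_(e <- zs) (z - e) * g z) ->
  nb_zeros S r f (size zs).
Proof.
move=> ST zsS qN0 dg gN0 HE.
have errE z : nm z < T ->
    reval r z - f z = \prod_(e <- zs) (z - e) * (g z / (rden r).[z]).
  by move=> zT; rewrite mulrA -HE /reval; field; exact: qN0.
exists zs; split=> //.
  move=> z; split=> [zzs|[Sz [_ /eqP]]].
    have Sz := zsS z zzs; split=> //; split.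
      by rewrite /pole rootE; apply: qN0; exact: ST.
    rewrite errE ?ST //; apply/eqP; rewrite mulf_eq0; apply/orP; left.
    by rewrite prodf_seq_eq0; apply/hasP; exists z; rewrite // subrr eqxx.
  rewrite errE ?ST // mulf_eq0 mulf_eq0 invr_eq0.
  rewrite (negbTE (gN0 z (ST z Sz))) (negbTE (qN0 z (ST z Sz))) !orbF.
  by rewrite prodf_seq_eq0 => /hasP[e ezs]; rewrite /= subr_eq0 => /eqP ->.
move=> z /zsS /ST zT.
pose P w : C := \prod_(e <- [seq e <- zs | e != z]) (w - e).
exists (fun w => P w * (g w / (rden r).[w])).
  rewrite !mulf_neq0 ?invr_eq0 ?gN0 ?qN0 //.
  rewrite prodf_seq_neq0; apply/allP => e; rewrite mem_filter subr_eq0 eq_sym.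
  by move=> /andP[ez _]; apply/implyP.
apply: (nbhsCP _ _).2; exists (T - nm z); first by rewrite subr_gt0.
move=> w hw; have wT : nm w < T by have := nmD (w - z) z; rewrite subrK; lra.
split; last by rewrite errE // (prod_sub_split zs z w) -mulrA.
exact: derivableM (@derivable_prod_sub R _ w)
  (@derivable_quot R g (fun z => (rden r).[z]) w (qN0 w wT) (dg w wT)
     (@derivable_hornerC R (rden r) w)).
Qed.

End Counting.

Theorem proposition7p1 (R : realType) (m n : nat) (K : set (Cplx R))
    (K_nonempty : K !=set0) (K_compact : compact K)
    (K_perfect : isolated K = set0) :
  exists2 rho : R, 0 < rho &
    forall (E : set (Cplx R)) (f : Cplx R -> Cplx R),
      open E -> connected E -> E 0 -> holomorphic_on E f -> K `<=` E ->
    forall (rP : ratfun R) (a : Cplx R),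
      pade m n E f rP -> nondegenerate_in m n rP ->
      pade_coef m n f rP a -> a != 0 ->
    forall r : R -> ratfun R,
      (forall eps : R, 0 < eps -> dil eps K `<=` E ->
         best_approx (ratfuns m%:Z n%:Z) (dil eps K) f (r eps)) ->
    \forall eps \near 0^'+,
      [/\ dil eps K `<=` E,
          dil eps (dil rho disk) `<=` E,
          nb_zeros (dil eps (dil rho disk)) (r eps) f (m + n + 1)
        & best_approx (interpolatory m n E f (dil eps (dil rho disk)))
            (dil eps K) f (r eps)].
Proof.
set N := (m + n).+1.
have [kap kap1 Kkap] := compact_nm_bounded K_compact.
have [x xinj Kx] := perfect_points N K_nonempty K_perfect.
have [L L0 HL] := coef_le_values xinj.
pose rho : R := 64 * (N%:R * L * kap ^+ N) + 1.
have kap0 : 0 < kap := lt_le_trans ltr01 kap1.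
have kL : 0 <= N%:R * L * kap ^+ N.
  exact: mulr_ge0 (mulr_ge0 (ler0n _ _) L0) (exprn_ge0 _ (ltW kap0)).
have rho1 : 1 <= rho by rewrite /rho; lra.
have rhoL : 64 * (N%:R * L * kap ^+ N) <= rho by rewrite /rho; lra.
have rho0 : 0 < rho := lt_le_trans ltr01 rho1.
clearbody rho; exists rho => //.
move=> E f Eo _ E0 hf _ rP a hpade nondeg hcoef a0 r best.
have [p1 [q1 [v [[sp1 sq1 cop full] q10 rPE hv pade_eq]]]] :=
  pade_normal_form E0 hpade nondeg.
have v0 := pade_coef_neq0 Eo E0 q10 rPE hv pade_eq hcoef a0.
have q1n0 : q1 != 0.
  by apply/eqP => h; move: q10; rewrite h coef0 => /eqP; rewrite eq_sym oner_eq0.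
have b0 : 0 < nm (v 0) by rewrite nm_gt0.
have [d [d0 d1 loc]] : exists d : R, [/\ 0 < d, d <= 1 & forall z, nm z < d ->
    [/\ E z, nm (q1.[z] - 1) <= 1 / 16 & nm (v z - v 0) <= nm (v 0) / 16]].
  have [e1 e10 H1] := (nbhsCP _ _).1 (open_nbhs_nbhs (conj Eo E0)).
  have s0 : (0 : R) < 1 / 16 by rewrite divr_gt0.
  have b16 : 0 < nm (v 0) / 16 by rewrite divr_gt0.
  have [e2 e20 H2] := (continuousCP _ _).1
    (derivable_continuousC (@derivable_hornerC R q1 0)) _ s0.
  have [e3 e30 H3] := (continuousCP _ _).1 (derivable_continuousC (hv 0 E0)) _ b16.
  exists (Num.min (Num.min 1 e1) (Num.min e2 e3)); split.
  - by rewrite !lt_min ltr01 e10 e20 e30.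
  - by rewrite !ge_min lexx.
  move=> z; rewrite !lt_min => /andP[/andP[_ z1] /andP[z2 z3]].
  have := H1 z; have := H2 z; have := H3 z; rewrite !subr0.
  rewrite (horner_coef0 q1) q10.
  by move=> /(_ z3)/ltW g3 /(_ z2)/ltW g2 /(_ z1) g1.
(* the ratio of the radii required by [zero_count] *)
pose R1 : R := 12 * 4 ^+ (N + 3).
have R11 : 1 <= R1.
  have : 1 <= (4 : R) ^+ (N + 3) by rewrite exprn_ege1 // ler1n.
  by rewrite /R1; lra.
have [e0 e00 annulus] := near_pade_annulus kap1 L0 HL (fun i => Kkap _ (Kx i))
  rho1 rhoL R11 sp1 sq1 cop full q10 v0 d0 d1 loc pade_eq.
have W0 : 0 < R1 * rho * kap.
  by rewrite !mulr_gt0 // (lt_le_trans ltr01).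
pose e1 := Num.min e0 (d / (R1 * rho * kap)).
have e10 : 0 < e1 by rewrite lt_min e00 divr_gt0.
suff main : forall eps, 0 < eps -> eps < e1 ->
      [/\ dil eps K `<=` E,
          dil eps (dil rho disk) `<=` E,
          nb_zeros (dil eps (dil rho disk)) (r eps) f (m + n + 1)
        & best_approx (interpolatory m n E f (dil eps (dil rho disk)))
            (dil eps K) f (r eps)].
  near=> eps; apply: main; near: eps; [exact: nbhs_right_gt|exact: nbhs_right_lt].
move=> eps eps0; rewrite lt_min ltr_pdivlMr // => /andP[ee0 eW].
have RE z : nm z <= R1 * (eps * rho) -> E z.
  move=> hz; suff zd : nm z < d by have [] := loc z zd.
  apply: le_lt_trans hz (le_lt_trans _ eW).
  have -> : R1 * (eps * rho) = eps * (R1 * rho) by ring.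
  rewrite ler_pM2l // ler_peMr // mulr_ge0 // ?(ltW rho0) //.
  exact: le_trans ler01 R11.
have ekW : eps * kap < d.
  apply: le_lt_trans eW; rewrite ler_pM2l // ler_peMl ?(ltW kap0) //.
  by rewrite mulr_ege1.
have KE : dil eps K `<=` E.
  move=> z /(dil_nm eps0 Kkap) hz.
  by have [] := loc z (le_lt_trans hz ekW).
have er0 : 0 < eps * rho by rewrite mulr_gt0.
have erR : eps * rho <= R1 * (eps * rho) by rewrite ler_peMl // ltW.
have DE : dil eps (dil rho disk) `<=` E.
  move=> z /(dil_diskP z eps0 rho0) hz; apply: RE; exact: le_trans hz erR.
have [rmn rbest] := best eps eps0 KE.
have [sp sq] := ratfuns_reduced rmn.
have rPmn : ratfuns m%:Z n%:Z rP.
  by exists p1, q1; split=> //; apply/deg_leP.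
have padeerr : (sup_dist (dil eps K) rP f <=
    (2 * nm (v 0) * (kap ^+ N * eps ^+ N))%:E)%E.
  apply: sup_dist_le => z /(dil_nm eps0 Kkap) hz.
  have [q1z err] := pade_error kap1 v0 loc pade_eq eps0 ekW hz.
  by have [np ->] := reval_ratio q1n0 rPE q1z.
have rerr z : dil eps K z ->
    ~~ pole (r eps) z /\ nm (reval (r eps) z - f z) <=
       2 * nm (v 0) * (kap ^+ N * eps ^+ N).
  by apply: le_sup_dist; exact: le_trans (rbest _ rPmn) padeerr.
have dilx i : dil eps K ((eps%:C)%C * x i) by exists (x i).
have [lam0 qN0 ann] := annulus eps eps0 ee0 (rnum (r eps)) (rden (r eps)) sp sq
  (rden_neq0 _) (fun i => (rerr _ (dilx i)).1) (fun i => (rerr _ (dilx i)).2).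
set lam := _ / 2 in lam0 ann.
pose H z := (rnum (r eps)).[z] - (rden (r eps)).[z] * f z.
have dH z : E z -> derivable H z 1.
  move=> Ez; exact: derivableB (@derivable_hornerC R (rnum (r eps)) z)
    (derivableM (@derivable_hornerC R (rden (r eps)) z) (hf z Ez)).
have [zs [g [[zss dg HE] szs gN0]]] :=
  @zero_count R E H N (eps * rho) lam Eo dH er0 lam0 RE ann.
have zsD z : z \in zs -> dil eps (dil rho disk) z.
  by move=> /zss hz; apply/(dil_diskP z eps0 rho0); exact: ltW.
have nbz : nb_zeros (dil eps (dil rho disk)) (r eps) f (m + n + 1).
  rewrite addn1 -/N -szs.
  have R12 : 12 <= R1.
    have : 1 <= (4 : R) ^+ (N + 3) by rewrite exprn_ege1 // ler1n.
    by rewrite /R1; lra.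
  apply: (@nb_zeros_of_factors R _ (r eps) f zs g (R1 * (eps * rho))) => //.
  - move=> z /(dil_diskP z eps0 rho0) hz; apply: le_lt_trans hz _.
    by rewrite ltr_pMl //; lra.
  - by move=> z /ltW; exact: qN0.
  - by move=> z /ltW /RE; exact: dg.
  - by move=> z /ltW; exact: gN0.
split=> //; split; last first.
  move=> r' [s _ [_ [p [q [dp dq q0 r'E _]]]]]; apply: rbest.
  by exists p, q.
have szs' : size zs == N by apply/eqP.
exists (Tuple szs') => //; split; first by move=> z /zsD /DE.
exists (rnum (r eps)), (rden (r eps)); split.
- exact/deg_leP.
- exact/deg_leP.
- exact: rden_neq0.
- by rewrite ratio_of_reduced.
- by exists g => // z _; rewrite [g z * _]mulrC; exact: HE.
Unshelve. all: by end_near. Qed.
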